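(* (Generalized flow scheduling.) For every $\epsilon>0$ there is a $(1+\epsilon)$-speed $O(1/\epsilon^2)$-competitive online algorithm for minimizing total weighted flow time in the generalized flow scheduling problem.
   Context: Generalized flow scheduling: given a finite directed network $G=(V,E)$ whose source nodes $J\subseteq V$ are the jobs; arc $e$ has capacity $u_e\ge0$ and gain factor $\gamma_e>0$ (a flow of value $f$ becomes $\gamma_ef$ after flowing through $e$); node $v$ has excess capacity $b_v$, nonnegative for sources. At each time, the jobs can be processed at rates $\mathbf z\ge0$ iff $\mathbf z\in\mathcal P$, where $$\mathcal P=\Big\{\mathbf z=\Big(\sum_w(f_{jw}-\gamma_{wj}f_{wj})\Big)_{j\in J}\ :\ \sum_w(f_{vw}-\gamma_{wv}f_{wv})\le b_v\ \forall v\in V;\ f_e\le u_e\ \forall e\in E;\ \mathbf f\ge0\Big\},$$ i.e. job $j$ is processed at a rate equal to its outgoing net flow. The set of feasible nonnegative rate vectors is assumed downward-closed, and every job can be processed at some positive rate. Job $j$ arrives online at time $r_j$ with size $p_j>0$ and weight $w_j\ge0$, revealed to the online algorithm only at time $r_j$; preemption is free. $C_j$ is the first time job $j$ has been processed for $p_j$ units since $r_j$. Total weighted flow time is $\sum_jw_j(C_j-r_j)$. With speed $s$, feasible rates are multiplied by $s$; an online algorithm is $s$-speed $c$-competitive if on every (finite) job sequence its objective with speed $s$ is at most $c$ times that of an optimal offline schedule with speed $1$. $O(\cdot)$ hides an absolute constant ($\epsilon$ is thought of as small). *)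

(* Defs.v *)
From HB Require Import structures.
From mathcomp Require Import all_boot all_order all_algebra.
From mathcomp Require Import all_classical all_reals all_analysis.

Set Implicit Arguments.
Unset Strict Implicit.
Unset Printing Implicit Defensive.

Import Order.TTheory GRing.Theory Num.Theory.
Import numFieldNormedType.Exports.

Local Open Scope classical_set_scope.
Local Open Scope ring_scope.

(* [cap] and [gain] are only meaningful on the pairs belonging to [arcs]. *)
Record network (R : realType) (V : finType) := Network {
  arcs : {set V * V};
  sources : {set V};
  cap : V * V -> R;
  gain : V * V -> R;
  excess : V -> R;
  cap_ge0 : forall e, e \in arcs -> 0 <= cap e;
  gain_gt0 : forall e, e \in arcs -> 0 < gain e;
  excess_ge0 : forall v, v \in sources -> 0 <= excess v
}.

Section Network.
Variables (R : realType) (V : finType) (N : network R V).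

Definition job : finType := {v : V | v \in sources N}.

Definition net_outflow (f : V * V -> R) (v : V) : R :=
  \sum_(w | (v, w) \in arcs N) f (v, w)
  - \sum_(w | (w, v) \in arcs N) gain N (w, v) * f (w, v).

Definition feasible_flow (f : V * V -> R) : Prop :=
  (forall v, net_outflow f v <= excess N v) /\
  (forall e, e \in arcs N -> 0 <= f e <= cap N e).

Definition rate_polytope : set (job -> R) :=
  [set (fun j : job => net_outflow f (val j)) | f in feasible_flow].

Definition feasible_rates : set (job -> R) :=
  [set z | rate_polytope z /\ forall j, 0 <= z j].

(* Containing 0 is part of being downward-closed: the empty set is excluded.
   This only matters for a network without jobs. *)
Definition downward_closed (S : set (job -> R)) : Prop :=
  S (fun=> 0) /\
  forall z z' : job -> R, S z -> (forall j, 0 <= z' j <= z j) -> S z'.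

Definition admissible : Prop :=
  downward_closed feasible_rates /\
  forall j : job, exists2 z, feasible_rates z & 0 < z j.

Record job_sequence := JobSequence {
  release : job -> R;
  job_size : job -> R;
  weight : job -> R;
  release_ge0 : forall j, 0 <= release j;
  job_size_gt0 : forall j, 0 < job_size j;
  weight_ge0 : forall j, 0 <= weight j
}.

(* The rate of every job at every time; only times [t >= 0] matter. *)
Definition schedule := R -> job -> R.

(* Work done on [j] during [release j, t]. Rates given to [j] before its
   release are allowed but wasted. *)
Definition processed (I : job_sequence) (z : schedule) (j : job) (t : R)
    : \bar R :=
  (\int[lebesgue_measure]_(x in `[release I j, t]) (z x j)%:E)%E.

(* The infimum is attained whenever it is finite, and is +oo when [j] is never
   completed. *)
Definition completion (I : job_sequence) (z : schedule) (j : job) : \bar R :=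
  ereal_inf [set t%:E | t in [set t | ((job_size I j)%:E <= processed I z j t)%E]].

Definition weighted_flow_time (I : job_sequence) (z : schedule) : \bar R :=
  (\sum_(j : job) (weight I j)%:E * (completion I z j - (release I j)%:E))%E.

(* Jobs of weight 0 must be completed as well. *)
Definition feasible_schedule (s : R) (I : job_sequence) (z : schedule) : Prop :=
  [/\ forall j, measurable_fun (`[0, +oo[ : set (measurableTypeR R)) (fun t => z t j),
      forall t, 0 <= t ->
        [set (fun j => s * z' j) | z' in feasible_rates] (z t)
    & forall j, (completion I z j < +oo)%E].

Definition optimal_cost (s : R) (I : job_sequence) : \bar R :=
  ereal_inf [set weighted_flow_time I z | z in feasible_schedule s I].

(* The same jobs, with the same parameters, have arrived by time [t]. *)
Definition same_arrivals (t : R) (I I' : job_sequence) : Prop :=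
  forall j, release I j <= t \/ release I' j <= t ->
    [/\ release I j = release I' j, job_size I j = job_size I' j
      & weight I j = weight I' j].

End Network.

(* The network is an input known from the start; the rates at time [t] may
   depend on the job sequence only through the jobs that arrived by time [t].
   Past decisions need not be passed explicitly, being themselves determined
   by these arrivals. *)
Record online_algorithm (R : realType) := OnlineAlgorithm {
  run :> forall (V : finType) (N : network R V), job_sequence N -> schedule N;
  nonanticipative : forall (V : finType) (N : network R V)
      (I I' : job_sequence N) (t : R),
    same_arrivals t I I' -> forall j, run I t j = run I' t j
}.

Definition competitive (R : realType) (s c : R) (A : online_algorithm R)
    : Prop :=
  forall (V : finType) (N : network R V), admissible N ->
  forall I : job_sequence N,
    feasible_schedule s I (A V N I) /\
    (weighted_flow_time I (A V N I) <= c%:E * optimal_cost 1 I)%E.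

(* Main.v *)
Require Import Defs.
From mathcomp Require Import all_boot all_order all_algebra.
From mathcomp Require Import all_classical all_reals all_analysis.
From mathcomp Require Import measurable_realfun.
From mathcomp Require Import ring lra.

Set Implicit Arguments.
Unset Strict Implicit.
Unset Printing Implicit Defensive.

Import Order.TTheory GRing.Theory Num.Theory.
Import numFieldNormedType.Exports.

Local Open Scope classical_set_scope.
Local Open Scope ring_scope.

(** The algorithm simulates speed [1 + 2 eta]: at each arrival it recomputes a
    nearly optimal schedule of the remaining work for the fractional weighted
    completion time, and follows it until the next arrival (gradient descent on
    the residual optimum [f]).  With [x] and [y] the residual work of the
    algorithm and of the optimum, the potential is [f x - f (x + y) / 2].
    Between arrivals [f x] decreases at rate (speed) * (fractional weight of
    [x]), while [f (x + y)] cannot decrease faster than (sum of the two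
    speeds) * (fractional weight of [x + y]).  An arrival [p] does not increase
    the potential because [f] has increasing differences:
      [f (x + d) + f (x + v) <= f (x + d + v) + f x]   for [d, v >= 0].
    This inequality comes from splitting the difference of two time-expanded
    generalized flows in two parts, one for each of the supplies [d] and [v].
    A further factor [1 + eta] of speed turns fractional flow time into integral
    flow time. *)

(** * Exchange property of generalized flows *)

(** The factor 1/2 balances an arrival: the new job enters [x] once but [x + y] twice, so half of
    its effect on [f (x + y)] covers its effect on [f x]. With speeds [spd] of the simulation and
    [sg] of the optimum, what remains of the drift is -(spd - sg)/2 times the weight of [x] and
    +(spd + sg)/2 times that of [y].

    Three gaps separate this computation from actual schedules. The infimum [f] is not known to be
    attained, so each replanning loses a slack, charged to a 1/#jobs share of the cost of the
    optimum. The competitor is an arbitrary measurable schedule while plans are finite lists of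
    constant rates; averaging its rates costs a factor 1 + eta, so it counts as having speed sg = 1
    + eta, still below 1 + 2 eta. Finally, [f] is not differentiated: the drift is a one-sided
    inequality on short intervals with quadratic error.

    The speed gap eta/2 and the fraction eta/(1 + eta) of an uncompleted job that the simulation
    still holds multiply, whence the ratio of order 1/eta^2. *)

(** Knaster-Tarski: the pointwise supremum [m] of the post-fixed points is post-fixed by
    monotonicity, hence so is [T m], which therefore lies below [m]. *)
Lemma monotone_cube_fixpoint (R : realType) (K : Type)
    (T : (K -> R) -> K -> R) :
  (forall c c', (forall k, 0 <= c k <= 1) -> (forall k, 0 <= c' k <= 1) ->
     (forall k, c k <= c' k) -> forall k, T c k <= T c' k) ->
  (forall c, (forall k, 0 <= c k <= 1) -> forall k, 0 <= T c k <= 1) ->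
  exists2 c : K -> R, forall k, 0 <= c k <= 1 & forall k, T c k = c k.
Proof.
move=> Tmono Tcube.
pose S := [set c : K -> R | (forall k, 0 <= c k <= 1) /\
                            forall k, c k <= T c k].
have S0 : S (fun=> 0).
  split=> k; first by rewrite lexx ler01.
  by have /andP[] := Tcube (fun=> 0) (fun=> introT andP (conj (lexx _) ler01)) k.
pose A k := [set c k | c in S].
have A0 k : A k 0 by exists (fun=> 0).
have ubA k : ubound (A k) 1 by move=> _ [c [c01 _] <-]; have /andP[] := c01 k.
have supA k : has_sup (A k) by split; [exists 0|exists 1].
pose m k := sup (A k).
have lem c k : S c -> c k <= m k.
  by move=> Sc; apply: ub_le_sup; [exists 1|exists c].
have m01 k : 0 <= m k <= 1.
  by rewrite (lem (fun=> 0)) //=; apply: ge_sup => //; exists 0.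
have mT k : m k <= T m k.
  apply: ge_sup; first by exists 0.
  move=> _ [c Sc <-]; apply: (le_trans (Sc.2 k)).
  by apply: Tmono => //; [exact: Sc.1|move=> k'; exact: lem].
exists m => // k; apply/eqP; rewrite eq_le mT andbT.
apply: (lem (T m)); split; first exact: Tcube.
by apply: Tmono => //; exact: Tcube.
Qed.

Section Rates.
Variables (R : realType) (V : finType) (N : network R V).
Implicit Types (f : V * V -> R) (z : job N -> R).

Lemma net_outflowD f f' v :
  net_outflow N (fun e => f e + f' e) v = net_outflow N f v + net_outflow N f' v.
Proof.
rewrite /net_outflow big_split /=.
under [X in _ - X]eq_bigr do rewrite mulrDr.
by rewrite big_split /=; ring.
Qed.

Lemma net_outflowZ a f v :
  net_outflow N (fun e => a * f e) v = a * net_outflow N f v.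
Proof.
rewrite /net_outflow mulrBr !mulr_sumr; congr (_ - _).
by apply: eq_bigr => w _; ring.
Qed.

Lemma feasible_rates_convex a b z z' : 0 <= a -> 0 <= b -> a + b = 1 ->
  feasible_rates z -> feasible_rates z' ->
  @feasible_rates R V N (fun j => a * z j + b * z' j).
Proof.
move=> a0 b0 ab1 [[f [fx fc] fz] z0] [[f' [fx' fc'] fz'] z0'].
split; last by move=> j; rewrite addr_ge0 // mulr_ge0.
exists (fun e => a * f e + b * f' e).
  split=> [v|e eN].
    rewrite net_outflowD !net_outflowZ.
    apply: (@le_trans _ _ (a * excess N v + b * excess N v)).
      by rewrite lerD // ler_wpM2l.
    by rewrite -mulrDl ab1 mul1r.
  have /andP[f0 fu] := fc _ eN; have /andP[f0' fu'] := fc' _ eN.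
  rewrite addr_ge0 ?mulr_ge0 //=.
  apply: (@le_trans _ _ (a * cap N e + b * cap N e)).
    by rewrite lerD // ler_wpM2l.
  by rewrite -mulrDl ab1 mul1r.
by apply/funext => j; rewrite net_outflowD !net_outflowZ -fz -fz'.
Qed.

(** The summand 1 keeps the bound positive on a network without arcs, since the slack divides by
    it. *)
Definition rate_bound : R := 1 + \sum_(e in arcs N) cap N e.

Lemma rate_bound_gt0 : 0 < rate_bound.
Proof. by rewrite ltr_pwDl // sumr_ge0 // => e /cap_ge0. Qed.

Lemma feasible_rates_bounded z j : feasible_rates z -> z j <= rate_bound.
Proof.
move=> [[f [fx fc] <-] _]; rewrite /net_outflow.
apply: (@le_trans _ _ (\sum_(w | (val j, w) \in arcs N) f (val j, w))).
  rewrite lerBlDr lerDl sumr_ge0 // => w wN; apply: mulr_ge0.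
    by rewrite ltW // gain_gt0.
  by have /andP[] := fc _ wN.
apply: (@le_trans _ _ (\sum_(w | (val j, w) \in arcs N) cap N (val j, w))).
  by apply: ler_sum => w wN; have /andP[] := fc _ wN.
rewrite /rate_bound -[leLHS]add0r lerD //.
have -> : \sum_(e in arcs N) cap N e =
    \sum_v \sum_(w | (v, w) \in arcs N) cap N (v, w).
  by rewrite pair_big_dep /=; apply: eq_big => -[].
rewrite [leRHS](bigD1 (val j)) //= lerDl; apply: sumr_ge0 => v _.
by apply: sumr_ge0 => w /cap_ge0.
Qed.

Let pos (x : R) : R := Num.max x 0.
Let neg (x : R) : R := Num.max (- x) 0.

Let pos_ge0 x : 0 <= pos x. Proof. by rewrite le_max lexx orbT. Qed.
Let neg_ge0 x : 0 <= neg x. Proof. by rewrite le_max lexx orbT. Qed.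
Let posBneg x : pos x - neg x = x.
Proof. by rewrite /pos /neg; case: (leP x 0); case: (leP (- x) 0); lra. Qed.

Let ratio01 (a b : R) : 0 <= a <= b -> 0 <= a / b <= 1.
Proof.
case/andP=> a0 ab; have b0 := le_trans a0 ab.
rewrite divr_ge0 //=; have [->|bn0] := eqVneq b 0; first by rewrite invr0 mulr0.
by rewrite ler_pdivrMr ?mul1r // lt_def bn0.
Qed.

Let ratioK (a b : R) : 0 <= a <= b -> a / b * b = a.
Proof.
case/andP=> a0 ab; have [b0|bn0] := eqVneq b 0; last by rewrite divfK.
by rewrite b0 mulr0; apply/eqP; rewrite eq_le a0 /= -b0.
Qed.

Let conv01 (x c : R) : 0 <= x -> 0 <= c <= 1 -> 0 <= x * c <= x.
Proof. by move=> x0 /andP[c0 c1]; rewrite mulr_ge0 //= ler_piMr. Qed.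

Let subr_bnd (a A b B : R) : 0 <= a <= A -> 0 <= b <= B -> - B <= a - b <= A.
Proof. by move=> /andP[? ?] /andP[? ?]; apply/andP; split; lra. Qed.

(** A number [y] between 0 and [a - b] moves [a] and [b] towards each other by the same amount, so
    the results inherit every bound shared by [a] and [b]. This serves for capacities, excesses and
    signs alike. *)
Let between (a b m y : R) : - neg (a - b) <= y <= pos (a - b) ->
  (a <= m -> b <= m -> (b + y <= m) /\ (a - y <= m)) /\
  (m <= a -> m <= b -> (m <= b + y) /\ (m <= a - y)).
Proof.
rewrite /pos /neg; case: (leP (a - b) 0); case: (leP (- (a - b)) 0) => ? ? /andP[? ?];
  split => ? ?; split; lra.
Qed.

(* The difference of the two flows, over all time steps, carries supplies [d]
   and [v].  Mix the flow entering a node (after reversing the arcs where the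
   difference is negative) proportionally: the fraction of [d]-flow at the nodes
   is a fixpoint of a monotone map on a cube.  The index [(u, Some i)] is the
   node [u] in step [i]; [(u, None)] is the node linking all the copies of
   [u], where the supplies enter. *)
Lemma rates_exchange (I : finType) (tau : I -> R) (q q' : I -> job N -> R)
    (x d v : job N -> R) :
  (forall i, 0 <= tau i) ->
  (forall i, feasible_rates (q i)) -> (forall i, feasible_rates (q' i)) ->
  (forall j, 0 <= d j) -> (forall j, 0 <= v j) ->
  (forall j, \sum_i tau i * q i j = x j + d j + v j) ->
  (forall j, \sum_i tau i * q' i j = x j) ->
  exists g g' : I -> job N -> R,
    [/\ forall i, feasible_rates (g i), forall i, feasible_rates (g' i),
        forall i j, g i j + g' i j = q i j + q' i j &
        forall j, \sum_i tau i * g i j = x j + d j].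
Proof.
move=> tau0 Qq Qq' d0 v0 qE q'E.
have /choice[F FP] i : exists f, feasible_flow N f /\
    (fun j : job N => net_outflow N f (val j)) = q i.
  by have [[f ? ?] _] := Qq i; exists f.
have /choice[F' F'P] i : exists f, feasible_flow N f /\
    (fun j : job N => net_outflow N f (val j)) = q' i.
  by have [[f ? ?] _] := Qq' i; exists f.
pose D i e := F i e - F' i e.
pose nD i u := net_outflow N (D i) u.
have nDE i u : nD i u = net_outflow N (F i) u - net_outflow N (F' i) u.
  rewrite /nD -[- net_outflow N (F' i) u]mulN1r -net_outflowZ -net_outflowD.
  by congr net_outflow; apply/funext => e; rewrite /D mulN1r.
(* After reversing the arcs of negative difference, [inc i c u] is the flow entering [u] in step
   [i], each unit coming from [w] counted with the fraction [c w], and [out i u] is the flow leaving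
   [u]. The gain of a reversed arc applies at its new tail. *)
pose inc i (c : V -> R) u :=
  \sum_(w | (w, u) \in arcs N) gain N (w, u) * pos (D i (w, u)) * c w +
  \sum_(w | (u, w) \in arcs N) neg (D i (u, w)) * c w.
pose out i u :=
  \sum_(w | (u, w) \in arcs N) pos (D i (u, w)) +
  \sum_(w | (w, u) \in arcs N) gain N (w, u) * neg (D i (w, u)).
have inc_mono i (c c' : V -> R) u : (forall w, c w <= c' w) ->
    inc i c u <= inc i c' u.
  move=> cc'; rewrite lerD // ler_sum // => w wN; rewrite ler_wpM2l //.
  by rewrite mulr_ge0 // ltW // gain_gt0.
have inc0 i u : inc i (fun=> 0) u = 0.
  by rewrite /inc !big1 ?addr0 // => w _; rewrite mulr0.
have nD_outin i u : nD i u = out i u - inc i (fun=> 1) u.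
  rewrite /nD /net_outflow /out /inc.
  under eq_bigr do rewrite -[D _ _]posBneg.
  rewrite sumrB.
  under [X in _ - _ - X]eq_bigr do rewrite -[D _ _]posBneg mulrBr.
  rewrite sumrB.
  under [X in _ = _ - (X + _)]eq_bigr do rewrite mulr1.
  under [X in _ = _ - (_ + X)]eq_bigr do rewrite mulr1.
  ring.
pose ext (a : job N -> R) u := if insub u is Some j then a j else 0.
have ext0 a u : (forall j, 0 <= a j) -> 0 <= ext a u.
  by move=> a0; rewrite /ext; case: insub.
have extE a j : ext a (val j) = a j by rewrite /ext valK.
(* Mixing equations. A copy of [u] with [nD i u < 0] sends its surplus to the link node, and one
   with [nD i u > 0] draws from it; [tau] converts rates into work. The supply [d] has fraction 1
   and [v] has fraction 0, so [v] only enters the denominator. *)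
pose nume (c : V * option I -> R) u :=
  ext d u + \sum_i tau i * neg (nD i u) * c (u, Some i).
pose dene u := ext d u + ext v u + \sum_i tau i * neg (nD i u).
pose numi (c : V * option I -> R) u i :=
  inc i (fun w => c (w, Some i)) u + pos (nD i u) * c (u, None).
pose deni u i := inc i (fun=> 1) u + pos (nD i u).
pose T c (k : V * option I) :=
  if k.2 is Some i then numi c k.1 i / deni k.1 i else nume c k.1 / dene k.1.
have nume01 c u : (forall k, 0 <= c k <= 1) -> 0 <= nume c u <= dene u.
  move=> c01; rewrite {1}/nume addr_ge0 ?ext0 //=; last first.
    by apply: sumr_ge0 => i _; rewrite !mulr_ge0 //; case/andP: (c01 (u, Some i)).
  rewrite /nume /dene lerD ?lerDl ?ext0 // ler_sum // => i _.
  have t0 : 0 <= tau i * neg (nD i u) by rewrite mulr_ge0.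
  by case/andP: (conv01 t0 (c01 (u, Some i))).
have numi01 c u i : (forall k, 0 <= c k <= 1) -> 0 <= numi c u i <= deni u i.
  move=> c01; rewrite {1}/numi addr_ge0 /=.
  - rewrite /numi /deni lerD //; last by case/andP: (conv01 (pos_ge0 (nD i u)) (c01 (u, None))).
    by apply: inc_mono => w; case/andP: (c01 (w, Some i)).
  - by rewrite -(inc0 i u); apply: inc_mono => w; case/andP: (c01 (w, Some i)).
  - by rewrite mulr_ge0 //; case/andP: (c01 (u, None)).
have all1 : forall k : V * option I, 0 <= (fun=> 1 : R) k <= 1 by move=> k; rewrite ler01 lexx.
(* [T] is monotone because the denominators are constant in [c] and the coefficients nonnegative.
   Where nothing flows, division by 0 gives fraction 0. *)
have [c c01 cT] : exists2 c : V * option I -> R,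
    forall k, 0 <= c k <= 1 & forall k, T c k = c k.
  apply: monotone_cube_fixpoint => [c c' c01 c01' cc' [u [i|]]|c c01 [u [i|]]];
    rewrite /T /=.
  - apply: ler_wpM2r; last by rewrite lerD ?ler_wpM2l //; apply: inc_mono.
    by case/andP: (numi01 _ u i all1) => h1 h2; rewrite invr_ge0 (le_trans h1).
  - apply: ler_wpM2r; last first.
      by rewrite lerD // ler_sum // => i _; rewrite ler_wpM2l ?mulr_ge0.
    by case/andP: (nume01 _ u all1) => h1 h2; rewrite invr_ge0 (le_trans h1).
  - exact/ratio01/numi01.
  - exact/ratio01/nume01.
have ci u i : c (u, Some i) * deni u i = numi c u i.
  by rewrite -[c (u, Some i)]cT /T /= ratioK //; exact: numi01.
have ce u : c (u, None) * dene u = nume c u.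
  by rewrite -[c (u, None)]cT /T /= ratioK //; exact: nume01.
(* The [d]-part of the difference: a forward arc carries the fraction of its tail, a reversed arc
   that of its head. *)
pose E i (e : V * V) :=
  pos (D i e) * c (e.1, Some i) - neg (D i e) * c (e.2, Some i).
pose nE i u := net_outflow N (E i) u.
have nEE i u : nE i u = pos (nD i u) * c (u, None) - neg (nD i u) * c (u, Some i).
  have -> : nE i u = c (u, Some i) * out i u - inc i (fun w => c (w, Some i)) u.
    rewrite /nE /net_outflow /E /= sumrB.
    under [X in _ - _ - X]eq_bigr do rewrite mulrBr.
    rewrite sumrB -!mulr_suml /out /inc.
    under [X in _ = _ - (X + _)]eq_bigr do rewrite -mulrA.
    under [X in _ - _ - (_ - X)]eq_bigr do rewrite mulrA.
    rewrite -!mulr_suml; ring.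
  have := ci u i; have := nD_outin i u; rewrite /numi /deni => h1 h2.
  have -> : out i u = inc i (fun=> 1) u + (pos (nD i u) - neg (nD i u)).
    by rewrite posBneg h1; ring.
  rewrite addrA mulrBr h2; ring.
have Ebnd i e : - neg (D i e) <= E i e <= pos (D i e).
  exact: (subr_bnd (conv01 (pos_ge0 _) (c01 _)) (conv01 (neg_ge0 _) (c01 _))).
have nEbnd i u : - neg (nD i u) <= nE i u <= pos (nD i u).
  rewrite nEE.
  exact: (subr_bnd (conv01 (pos_ge0 _) (c01 _)) (conv01 (neg_ge0 _) (c01 _))).
have nG i u : net_outflow N (fun e => F' i e + E i e) u = net_outflow N (F' i) u + nE i u.
  by rewrite net_outflowD.
have nG' i u : net_outflow N (fun e => F i e - E i e) u = net_outflow N (F i) u - nE i u.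
  rewrite -[- nE i u]mulN1r /nE -net_outflowZ -net_outflowD.
  by congr net_outflow; apply/funext => e; rewrite mulN1r.
have feas i : feasible_flow N (fun e => F' i e + E i e) /\
              feasible_flow N (fun e => F i e - E i e).
  have [[Fx Fc] _] := FP i; have [[Fx' Fc'] _] := F'P i.
  split; split=> [u|e eN].
  - have := nEbnd i u; rewrite nDE => /between h.
    by rewrite nG; have [] := (h (excess N u)).1 (Fx u) (Fx' u).
  - have /between h := Ebnd i e.
    have /andP[p1 p2] := Fc _ eN; have /andP[p3 p4] := Fc' _ eN.
    have [-> _] := (h (cap N e)).1 p2 p4.
    by have [-> _] := (h 0).2 p1 p3.
  - have := nEbnd i u; rewrite nDE => /between h.
    by rewrite nG'; have [] := (h (excess N u)).1 (Fx u) (Fx' u).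
  - have /between h := Ebnd i e.
    have /andP[p1 p2] := Fc _ eN; have /andP[p3 p4] := Fc' _ eN.
    have [_ ->] := (h (cap N e)).1 p2 p4.
    by have [_ ->] := (h 0).2 p1 p3.
have qF i j : net_outflow N (F i) (val j) = q i j by rewrite -(FP i).2.
have qF' i j : net_outflow N (F' i) (val j) = q' i j by rewrite -(F'P i).2.
have ge0 i j : 0 <= q' i j + nE i (val j) /\ 0 <= q i j - nE i (val j).
  have := nEbnd i (val j); rewrite nDE qF qF' => /between h.
  exact: (h 0).2 ((Qq i).2 j) ((Qq' i).2 j).
(* The [d]-part moves from the larger flow to the smaller one, which keeps the sum of the two in
   every step. *)
exists (fun i j => q' i j + nE i (val j)), (fun i j => q i j - nE i (val j)).
split=> [i|i|i j|j].
- split; last by move=> j; case: (ge0 i j).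
  exists (fun e => F' i e + E i e); first by case: (feas i).
  by apply/funext => j; rewrite nG qF'.
- split; last by move=> j; case: (ge0 i j).
  exists (fun e => F i e - E i e); first by case: (feas i).
  by apply/funext => j; rewrite nG' qF.
- ring.
- under eq_bigr do rewrite mulrDr; rewrite big_split /= q'E; congr (_ + _).
  under eq_bigr do rewrite nEE mulrBr !mulrA.
  rewrite sumrB -mulr_suml.
  have := ce (val j); rewrite /nume /dene !extE => ceE.
  (* Balance of the link node: it sends out exactly [dene]. Its [d]-part sent out is then
     [c * dene = nume], and subtracting the [d]-part received leaves [d j]. *)
  have -> : \sum_i tau i * pos (nD i (val j)) =
      d j + v j + \sum_i tau i * neg (nD i (val j)).
    apply/eqP; rewrite -subr_eq -sumrB; apply/eqP.
    under eq_bigr do rewrite -mulrBr posBneg nDE qF qF' mulrBr.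
    by rewrite sumrB qE q'E; ring.
  by rewrite [_ * c _]mulrC ceE; ring.
Qed.

End Rates.

(** * Plans and the residual optimum *)

Section Plans.
Variables (R : realType) (V : finType) (N : network R V).
Hypothesis adm : admissible N.
Implicit Types (z a b rho x v : job N -> R).

Definition plan := seq (R * (job N -> R)).

Fixpoint valid_plan (L : plan) : Prop :=
  if L is s :: L' then [/\ 0 <= s.1, feasible_rates s.2 & valid_plan L'] else True.

Fixpoint plan_total (L : plan) (j : job N) : R :=
  if L is s :: L' then s.1 * s.2 j + plan_total L' j else 0.

Definition dot rho z : R := \sum_j rho j * z j.

(* The fractional weighted completion time of a plan started at time [t]: the
   work of a step is completed on average in the middle of the step. *)
Fixpoint plan_cost rho (t : R) (L : plan) : R :=
  if L is s :: L' then
    s.1 * (t + s.1 / 2) * dot rho s.2 + plan_cost rho (t + s.1) L'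
  else 0.

Fixpoint plan_after (L : plan) (d : R) : plan :=
  if L is s :: L' then
    if d < s.1 then (s.1 - d, s.2) :: L' else plan_after L' (d - s.1)
  else [::].

Fixpoint plan_rate (L : plan) (d : R) : job N -> R :=
  if L is s :: L' then
    if d < s.1 then s.2 else plan_rate L' (d - s.1)
  else fun=> 0.

(** The work vectors achievable in time [tau] at speed 1; the existential form also makes sense for
    [tau = 0]. *)
Definition scaled_rates (tau : R) a :=
  exists2 z, feasible_rates z & forall j, a j = tau * z j.

Lemma dot_ge0 rho z :
  (forall j, 0 <= rho j) -> (forall j, 0 <= z j) -> 0 <= dot rho z.
Proof. by move=> r0 z0; apply: sumr_ge0 => j _; rewrite mulr_ge0. Qed.

Lemma ler_dot rho z a : (forall j, 0 <= rho j) -> (forall j, z j <= a j) ->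
  dot rho z <= dot rho a.
Proof. by move=> r0 za; apply: ler_sum => j _; rewrite ler_wpM2l. Qed.

Lemma eq_dot rho z a : (forall j, z j = a j) -> dot rho z = dot rho a.
Proof. by move=> za; apply: eq_bigr => j _; rewrite za. Qed.

Lemma dotD rho z a : dot rho (fun j => z j + a j) = dot rho z + dot rho a.
Proof. by rewrite -big_split; apply: eq_bigr => j _; rewrite mulrDr. Qed.

Lemma dotZ rho c z : dot rho (fun j => c * z j) = c * dot rho z.
Proof. by rewrite mulr_sumr; apply: eq_bigr => j _; ring. Qed.

Lemma feasible_rates0 : @feasible_rates R V N (fun=> 0).
Proof. by case: adm => -[]. Qed.

Lemma feasible_rates_le z a : feasible_rates z -> (forall j, 0 <= a j <= z j) ->
  feasible_rates a.
Proof. by case: adm => -[_ h] _; exact: h. Qed.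

Lemma positive_feasible_rates :
  exists2 z : job N -> R, feasible_rates z & forall j, 0 < z j.
Proof.
suff H (s : seq (job N)) :
    exists2 z, feasible_rates z & forall j, j \in s -> 0 < z j.
  by have [z Qz zP] := H (enum (job N)); exists z => // j; rewrite zP ?mem_enum.
elim: s => [|j s [z Qz zP]]; first by exists (fun=> 0) => //; exact: feasible_rates0.
have [z' Qz' z'j] := adm.2 j.
exists (fun k => 2^-1 * z k + 2^-1 * z' k).
  by apply: feasible_rates_convex => //; lra.
move=> k; rewrite inE => /orP[/eqP->|ks].
  by apply: ltr_wpDl; [rewrite mulr_ge0 ?Qz.2|rewrite mulr_gt0].
by apply: ltr_pwDl; [rewrite mulr_gt0 ?zP|rewrite mulr_ge0 ?Qz'.2].
Qed.

Lemma scaled_rates_add s t a b : 0 <= s -> 0 <= t ->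
  scaled_rates s a -> scaled_rates t b -> scaled_rates (s + t) (fun j => a j + b j).
Proof.
move=> s0 t0 [z Qz az] [z' Qz' bz]; have [st0|st0] := eqVneq (s + t) 0.
  exists (fun=> 0) => [|j]; first exact: feasible_rates0.
  by rewrite az bz; have -> : s = 0 by [lra]; have -> : t = 0 by [lra]; ring.
exists (fun j => s / (s + t) * z j + t / (s + t) * z' j).
  apply: feasible_rates_convex => //; rewrite ?divr_ge0 ?addr_ge0 //.
  by rewrite -mulrDl divff.
by move=> j; rewrite az bz; field.
Qed.

Lemma scaled_rates_le s a b : 0 <= s -> scaled_rates s a ->
  (forall j, 0 <= b j <= a j) -> scaled_rates s b.
Proof.
move=> s0 [z Qz az] ba; have [s00|sn0] := eqVneq s 0.
  exists z => // j; have := ba j; rewrite az s00 !mul0r => /andP[? ?].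
  by apply/eqP; rewrite eq_le; apply/andP.
have sp : 0 < s by rewrite lt_def sn0.
exists (fun j => b j / s) => [|j]; last by field.
apply: (feasible_rates_le Qz) => j; have /andP[b0 bj] := ba j.
by rewrite divr_ge0 //= ler_pdivrMr // mulrC -az.
Qed.

Lemma scaled_rates_bounded s a j : 0 <= s -> scaled_rates s a ->
  a j <= s * rate_bound N.
Proof.
by move=> s0 [z Qz ->]; rewrite ler_wpM2l //; exact: feasible_rates_bounded.
Qed.

Lemma scaled_rates_ge0 s a j : 0 <= s -> scaled_rates s a -> 0 <= a j.
Proof. by move=> s0 [z Qz ->]; rewrite mulr_ge0 ?Qz.2. Qed.

Lemma plan_total_ge0 L j : valid_plan L -> 0 <= plan_total L j.
Proof.
by elim: L => //= s L IH [s0 Qs vL]; rewrite addr_ge0 ?IH // mulr_ge0 ?Qs.2.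
Qed.

Lemma plan_cost_shift rho (t d : R) L :
  plan_cost rho (t + d) L = plan_cost rho t L + d * dot rho (plan_total L).
Proof.
elim: L t => [|s L IH] t /=.
  by rewrite /dot big1 ?mulr0 ?addr0 // => j _; rewrite mulr0.
by rewrite [t + d + s.1]addrAC IH dotD dotZ; ring.
Qed.

Lemma plan_cost_ge0 rho t L : (forall j, 0 <= rho j) -> 0 <= t ->
  valid_plan L -> 0 <= plan_cost rho t L.
Proof.
move=> r0; elim: L t => //= s L IH t t0 [s0 Qs vL].
rewrite addr_ge0 ?IH ?addr_ge0 // mulr_ge0 ?dot_ge0 //; last exact: Qs.2.
by rewrite mulr_ge0 // addr_ge0 // divr_ge0.
Qed.

(** Passes from the densities known to the algorithm, which are 0 for jobs still to come, to the
    true ones: a plan with total 0 on a job never works on it. *)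
Lemma plan_cost_support rho rho' t L : valid_plan L ->
  (forall j, rho j = rho' j \/ plan_total L j = 0) ->
  plan_cost rho t L = plan_cost rho' t L.
Proof.
elim: L t => //= s L IH t [s0 Qs vL] h.
have hj j : rho j = rho' j \/ (s.1 * s.2 j = 0 /\ plan_total L j = 0).
  have [->|/eqP] := h j; first by left.
  rewrite paddr_eq0 ?plan_total_ge0 ?mulr_ge0 ?Qs.2 //.
  by case/andP=> /eqP-> /eqP->; right.
congr (_ + _); last by apply: IH => // j; have [->|[]] := hj j; [left|right].
rewrite mulrAC [RHS]mulrAC -!dotZ; congr (_ * _).
by apply: eq_bigr => j _; have [->//|[-> _]] := hj j; rewrite !mulr0.
Qed.

Lemma valid_plan_after L d : 0 <= d -> valid_plan L -> valid_plan (plan_after L d).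
Proof.
elim: L d => //= s L IH d d0 [s0 Qs vL]; case: ltP => ds /=.
  by split => //; rewrite subr_ge0 ltW.
by apply: IH => //; rewrite subr_ge0.
Qed.

(** [plan_after L 0] may differ from [L], as it drops leading steps of length 0. *)
Lemma plan_after0 L : valid_plan L -> plan_total (plan_after L 0) = plan_total L.
Proof.
elim: L => //= s L IH [s0 Qs vL]; case: ltP => s1 /=; first by rewrite subr0.
have -> : s.1 = 0 by apply/eqP; rewrite eq_le s1.
by rewrite subr0 IH //; apply/funext => j; rewrite mul0r add0r.
Qed.

Lemma plan_cost_after0 rho L :
  valid_plan L -> plan_cost rho 0 (plan_after L 0) = plan_cost rho 0 L.
Proof.
elim: L => //= s L IH [s0 Qs vL]; case: ltP => s1 /=; first by rewrite subr0.
have -> : s.1 = 0 by apply/eqP; rewrite eq_le s1.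
by rewrite subr0 IH // addr0 !mul0r add0r.
Qed.

Lemma plan_after_after L d d' : 0 <= d -> 0 <= d' ->
  plan_after (plan_after L d) d' = plan_after L (d + d').
Proof.
elim: L d => //= s L IH d d0 d'0; case: ltP => ds /=.
  by rewrite ltrBrDl; case: ifP => h; rewrite ?opprD ?addrA //; congr plan_after; ring.
by rewrite IH ?subr_ge0 // ltNge (le_trans ds) ?lerDl //= addrAC.
Qed.

Lemma plan_after_scaled L d : 0 <= d -> valid_plan L ->
  scaled_rates d (fun j => plan_total L j - plan_total (plan_after L d) j).
Proof.
elim: L d => [|s L IH] d d0 /=.
  by exists (fun=> 0) => [|j]; [exact: feasible_rates0|rewrite subrr mulr0].
move=> [s0 Qs vL]; case: ltP => ds /=.
  by exists s.2 => // j; ring.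
have [] := @scaled_rates_add s.1 (d - s.1) (fun j => s.1 * s.2 j)
    (fun j => plan_total L j - plan_total (plan_after L (d - s.1)) j).
- by [].
- by rewrite subr_ge0.
- by exists s.2.
- by apply: IH => //; rewrite subr_ge0.
by move=> z Qz zE; exists z => // j; rewrite -addrA zE; congr (_ * _); ring.
Qed.

(** The work left after time [d] has waited during all of [d]; the cost of the work done meanwhile
    is nonnegative and dropped. This gives the decrease of [f x] along the followed plan. *)
Lemma plan_after_cost rho L d : (forall j, 0 <= rho j) -> 0 <= d -> valid_plan L ->
  d * dot rho (plan_total (plan_after L d)) + plan_cost rho 0 (plan_after L d)
    <= plan_cost rho 0 L.
Proof.
move=> r0; elim: L d => [|s L IH] d d0 /=.
  by rewrite /dot big1 ?mulr0 ?addr0 // => j _; rewrite mulr0.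
move=> [s0 Qs vL]; rewrite add0r.
have shift0 t : plan_cost rho t L = plan_cost rho 0 L + t * dot rho (plan_total L).
  by rewrite -plan_cost_shift add0r.
have D0 : 0 <= dot rho s.2 by apply: dot_ge0 => //; exact: Qs.2.
case: ltP => ds /=.
  rewrite !add0r dotD dotZ (shift0 s.1) (shift0 (s.1 - d)) -subr_ge0.
  set a := dot rho s.2; set b := dot rho _; set c := plan_cost _ _ _.
  suff -> : s.1 * (s.1 / 2) * a + (c + s.1 * b) -
    (d * ((s.1 - d) * a + b) + ((s.1 - d) * ((s.1 - d) / 2) * a + (c + (s.1 - d) * b)))
    = d ^+ 2 / 2 * a by rewrite mulr_ge0 // divr_ge0 // sqr_ge0.
  by field.
have ds0 : 0 <= d - s.1 by rewrite subr_ge0.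
rewrite add0r (shift0 s.1); have := IH _ ds0 vL.
have : dot rho (plan_total (plan_after L (d - s.1))) <= dot rho (plan_total L).
  apply: ler_dot => // j; rewrite -subr_ge0.
  exact: (scaled_rates_ge0 j ds0 (plan_after_scaled ds0 vL)).
set b := dot rho (plan_total L); set a := dot rho _.
set c := plan_cost _ _ L; set e := plan_cost _ _ _ => ab h.
have : 0 <= s.1 * (s.1 / 2) * dot rho s.2.
  by rewrite mulr_ge0 // mulr_ge0 // divr_ge0.
have : s.1 * a <= s.1 * b by rewrite ler_wpM2l.
move: h; rewrite mulrBl; lra.
Qed.

Lemma plan_rate_feasible L d : valid_plan L -> feasible_rates (plan_rate L d).
Proof.
elim: L d => [|s L IH] d /=; first by move=> _; exact: feasible_rates0.
by move=> [s0 Qs vL]; case: ifP => // _; exact: IH.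
Qed.

Definition plan_for x : set plan :=
  [set L | valid_plan L /\ forall j, plan_total L j = x j].

Lemma plan_for_nonempty x : (forall j, 0 <= x j) -> plan_for x !=set0.
Proof.
move=> x0; have [z Qz z0] := positive_feasible_rates.
pose tau := \sum_j x j / z j.
have tau0 : 0 <= tau by apply: sumr_ge0 => j _; rewrite divr_ge0 // ltW.
have [q Qq qE] : scaled_rates tau x.
  apply: (@scaled_rates_le tau (fun j => tau * z j)) => // [|j]; first by exists z.
  rewrite x0 -ler_pdivrMr // /tau (bigD1 j) //= lerDl.
  by apply: sumr_ge0 => k _; rewrite divr_ge0 // ltW.
by exists [:: (tau, q)]; split=> //= j; rewrite addr0.
Qed.

Definition opt_cost rho x : R := inf [set plan_cost rho 0 L | L in plan_for x].

Section Opt.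
Variable rho : job N -> R.
Hypothesis rho0 : forall j, 0 <= rho j.

Let lb0 x : lbound [set plan_cost rho 0 L | L in plan_for x] 0.
Proof. by move=> _ [L [vL _] <-]; exact: plan_cost_ge0. Qed.

Lemma opt_cost_ge0 x : (forall j, 0 <= x j) -> 0 <= opt_cost rho x.
Proof.
move=> x0; apply: lb_le_inf (@lb0 x).
by have [L xL] := plan_for_nonempty x0; exists (plan_cost rho 0 L), L.
Qed.

Lemma opt_cost_le x L : plan_for x L -> opt_cost rho x <= plan_cost rho 0 L.
Proof. by move=> xL; apply: ge_inf; [exists 0; exact: lb0|exists L]. Qed.

Lemma opt_cost_approx x e : (forall j, 0 <= x j) -> 0 < e ->
  exists2 L, plan_for x L & plan_cost rho 0 L < opt_cost rho x + e.
Proof.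
move=> x0 e0; have [L xL] := plan_for_nonempty x0.
have [_ [L' xL' <-] h] : exists2 y, [set plan_cost rho 0 L | L in plan_for x] y &
    y < opt_cost rho x + e.
  apply: inf_adherent => //; split; last by exists 0; exact: lb0.
  by exists (plan_cost rho 0 L), L.
by exists L'.
Qed.

(** Prepend to a nearly optimal plan for [y] one step of length [tau] doing [x - y]. That work is
    charged [tau / 2] only, hence at most [tau]. Applied to [x + y], this limits how fast its
    residual optimum can fall. *)
Lemma opt_cost_step tau x y : 0 <= tau -> (forall j, 0 <= y j) ->
  scaled_rates tau (fun j => x j - y j) ->
  opt_cost rho x <= tau * dot rho x + opt_cost rho y.
Proof.
move=> tau0 y0 [q Qq qE]; apply/ler_addgt0Pr => e e0.
have [L [vL LE] Le] := opt_cost_approx y0 e0.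
have xL : plan_for x ((tau, q) :: L).
  by split=> //= j; rewrite LE -qE subrK.
apply: (le_trans (opt_cost_le xL)) => /=.
have -> : dot rho x = tau * dot rho q + dot rho y.
  by rewrite -dotZ -dotD; apply: eq_dot => j; rewrite -qE subrK.
rewrite plan_cost_shift (eq_dot _ LE) add0r.
have : 0 <= tau * (tau / 2) * dot rho q.
  by rewrite !mulr_ge0 ?dot_ge0 //; exact: Qq.2.
lra.
Qed.

(** * Increasing differences of the residual optimum *)

Definition merged_plan := seq (R * ((job N -> R) * (job N -> R))).

Let left_plan (M : merged_plan) : plan := [seq (s.1, s.2.1) | s <- M].
Let right_plan (M : merged_plan) : plan := [seq (s.1, s.2.2) | s <- M].

(** The exchange needs both plans on the same time steps: cut at all step boundaries and pad the
    shorter plan with rate 0. Cutting a step keeps the cost, because the midpoint formula is exact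
    for a constant rate. *)
Lemma plan_merge L L' : valid_plan L -> valid_plan L' ->
  exists M : merged_plan,
  [/\ valid_plan (left_plan M), valid_plan (right_plan M),
      forall j, plan_total (left_plan M) j = plan_total L j,
      forall j, plan_total (right_plan M) j = plan_total L' j &
      forall t, plan_cost rho t (left_plan M) = plan_cost rho t L /\
                plan_cost rho t (right_plan M) = plan_cost rho t L'].
Proof.
have dot0 : dot rho (fun=> 0) = 0 by rewrite /dot big1 // => j _; rewrite mulr0.
have [n] := ubnP (size L + size L')%N.
elim: n L L' => // n IH [|[t q] L] [|[t' q'] L'] /=.
- by exists [::].
- rewrite add0n ltnS => sz _ [t0 Qq vL].
  have [|//|M [v1 v2 e1 e2 e3]] := IH [::] L' _ _ vL; first by rewrite add0n.
  exists ((t', (fun=> 0, q')) :: M); split=> //= [|j|j|u].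
  + by split=> //; exact: feasible_rates0.
  + by rewrite mulr0 add0r e1.
  + by rewrite e2.
  + by have [-> ->] := e3 (u + t'); rewrite dot0 mulr0 add0r.
- rewrite addn0 ltnS => sz [t0 Qq vL] _.
  have [|//|M [v1 v2 e1 e2 e3]] := IH L [::] _ vL; first by rewrite addn0.
  exists ((t, (q, fun=> 0)) :: M); split=> //= [|j|j|u].
  + by split=> //; exact: feasible_rates0.
  + by rewrite e1.
  + by rewrite mulr0 add0r e2.
  + by have [-> ->] := e3 (u + t); rewrite dot0 mulr0 add0r.
rewrite addSn addnS !ltnS => sz [t0 Qq vL] [t'0 Qq' vL'].
have [tt'|t't] := leP t t'.
  have [||M [v1 v2 e1 e2 e3]] := IH L ((t' - t, q') :: L') _ vL.
  + by rewrite /= addnS.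
  + by split=> //=; rewrite subr_ge0.
  exists ((t, (q, q')) :: M); split=> //= [j|j|u].
  + by rewrite e1.
  + by rewrite e2 /=; ring.
  + have [-> ->] := e3 (u + t); split=> //=.
    by rewrite (_ : u + t + (t' - t) = u + t'); [field|ring].
have [||//|M [v1 v2 e1 e2 e3]] := IH ((t - t', q) :: L) L'.
- by rewrite /= addSn.
- by split=> //=; rewrite subr_ge0 ltW.
exists ((t', (q, q')) :: M); split=> //= [j|j|u].
- by rewrite e1 /=; ring.
- by rewrite e2.
- have [-> ->] := e3 (u + t'); split=> //=.
  by rewrite (_ : u + t' + (t - t') = u + t); [field|ring].
Qed.

(** Nearly optimal plans for [x + d + v] and [x] are exchanged into plans for [x + d] and [x + v].
    Since the sum of the two rates is kept in every step and the cost is linear in the rates, the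
    total cost is the same. *)
Lemma opt_cost_exchange x (d v : job N -> R) :
  (forall j, 0 <= x j) -> (forall j, 0 <= d j) -> (forall j, 0 <= v j) ->
  opt_cost rho (fun j => x j + d j) + opt_cost rho (fun j => x j + v j) <=
  opt_cost rho (fun j => x j + d j + v j) + opt_cost rho x.
Proof.
move=> x0 d0 v0; apply/ler_addgt0Pr => e e0.
have e20 : 0 < e / 2 by rewrite divr_gt0.
have xdv0 j : 0 <= x j + d j + v j by rewrite !addr_ge0.
have [L [vL LE] Le] := opt_cost_approx xdv0 e20.
have [L' [vL' L'E] L'e] := opt_cost_approx x0 e20.
have [M [v1 v2 e1 e2 e3]] := plan_merge vL vL'.
pose I := 'I_(size M).
pose tau (i : I) := (tnth (in_tuple M) i).1.
pose q (i : I) := (tnth (in_tuple M) i).2.1.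
pose q' (i : I) := (tnth (in_tuple M) i).2.2.
pose mk (g : I -> job N -> R) (s : seq I) : plan := [seq (tau i, g i) | i <- s].
have ME : M = [seq tnth (in_tuple M) i | i <- enum I] by rewrite map_tnth_enum.
have lM : left_plan M = mk q (enum I).
  by rewrite /left_plan {1}ME -map_comp.
have rM : right_plan M = mk q' (enum I).
  by rewrite /right_plan {1}ME -map_comp.
have mk_total g s j : plan_total (mk g s) j = \sum_(i <- s) tau i * g i j.
  by elim: s => [|i s IH] /=; rewrite ?big_nil // big_cons IH.
have mk_valid (g : I -> job N -> R) s : (forall i, 0 <= tau i) ->
    (forall i, feasible_rates (g i)) -> valid_plan (mk g s).
  by move=> t0 Qg; elim: s => //= i s IH.
have valid_mk (g : I -> job N -> R) (s : seq I) : valid_plan (mk g s) ->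
    forall i, i \in s -> 0 <= tau i /\ feasible_rates (g i).
  elim: s => //= i s IH [t0 Qg vs] k; rewrite inE => /orP[/eqP->//|]; exact: IH.
have mk_cost g g' h h' s t : (forall i j, g i j + g' i j = h i j + h' i j) ->
    plan_cost rho t (mk g s) + plan_cost rho t (mk g' s) =
    plan_cost rho t (mk h s) + plan_cost rho t (mk h' s).
  move=> E; elim: s t => //= i s IH t; rewrite addrACA IH -mulrDr -dotD.
  by rewrite [RHS]addrACA -mulrDr -dotD; congr (_ * _ + _); apply: eq_dot.
have Vq := valid_mk q (enum I); rewrite -lM in Vq.
have Vq' := valid_mk q' (enum I); rewrite -rM in Vq'.
have enumI (i : I) : i \in enum I by rewrite mem_enum.
have [g [g' [Qg Qg' gE gx]]] : exists g g' : I -> job N -> R,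
    [/\ forall i, feasible_rates (g i), forall i, feasible_rates (g' i),
        forall i j, g i j + g' i j = q i j + q' i j &
        forall j, \sum_i tau i * g i j = x j + d j].
  apply: (@rates_exchange _ _ _ _ tau q q' x d v) => // [i|i|i|j|j].
  - by have [] := Vq v1 i (enumI i).
  - by have [] := Vq v1 i (enumI i).
  - by have [] := Vq' v2 i (enumI i).
  - by rewrite -LE -e1 lM mk_total big_enum.
  - by rewrite -L'E -e2 rM mk_total big_enum.
have t0 i : 0 <= tau i by have [] := Vq v1 i (enumI i).
have g1 : plan_for (fun j => x j + d j) (mk g (enum I)).
  by split=> [|j]; [exact: mk_valid|rewrite mk_total big_enum gx].
have g2 : plan_for (fun j => x j + v j) (mk g' (enum I)).
  split=> [|j]; first exact: mk_valid.
  have : plan_total (left_plan M) j + plan_total (right_plan M) j =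
         x j + d j + v j + x j by rewrite e1 e2 LE L'E.
  rewrite lM rM !mk_total !big_enum -big_split /=.
  under eq_bigr do rewrite -mulrDr -gE mulrDr.
  rewrite big_split /= gx; lra.
have := lerD (opt_cost_le g1) (opt_cost_le g2).
rewrite (mk_cost _ _ _ _ _ _ gE) -lM -rM; have [-> ->] := e3 0.
lra.
Qed.

End Opt.

Lemma eq_opt_cost rho x y : (forall j, x j = y j) -> opt_cost rho x = opt_cost rho y.
Proof. by move=> xy; congr opt_cost; apply/funext. Qed.

Lemma opt_cost_support rho rho' x :
  (forall j, rho j = rho' j \/ x j = 0) -> opt_cost rho x = opt_cost rho' x.
Proof.
move=> h; congr inf; apply/seteqP; split=> _ [L [vL LE] <-]; exists L => //.
  by apply: plan_cost_support => // j; rewrite LE; case: (h j) => ->; [left|right].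
by apply: plan_cost_support => // j; rewrite LE; apply: h.
Qed.

(* [u] is the union of the queues of the algorithm and of the optimum, where the
   job arrives twice. *)
Lemma opt_cost_arrival rho x u p : (forall j, 0 <= rho j) ->
  (forall j, 0 <= x j) -> (forall j, x j <= u j) -> (forall j, 0 <= p j) ->
  opt_cost rho (fun j => x j + p j) - opt_cost rho x <=
  (opt_cost rho (fun j => u j + p j + p j) - opt_cost rho u) / 2.
Proof.
move=> r0 x0 xu p0; have u0 j : 0 <= u j := le_trans (x0 j) (xu j).
have ux0 j : 0 <= u j - x j by rewrite subr_ge0.
(* The marginal cost of [p] at [x] is at most that at [u], which is at most that at [u + p]; so it
   is at most the average of the last two. *)
have := opt_cost_exchange r0 u0 p0 p0.
have := opt_cost_exchange r0 x0 p0 ux0.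
rewrite (_ : (fun j => x j + (u j - x j)) = u); last by apply/funext => j; ring.
rewrite (_ : (fun j => x j + p j + (u j - x j)) = fun j => u j + p j); last first.
  by apply/funext => j; ring.
lra.
Qed.

End Plans.

(** * The simulated gradient descent *)

Section Simulation.
Variables (R : realType) (V : finType) (N : network R V).
Implicit Types (rho : job N -> R).

Record arrival := Arrival {
  arr_job : job N; arr_time : R; arr_size : R; arr_weight : R }.

Record sim := Sim {
  clock : R; current : plan N; density : job N -> R; slack : R }.

(** Step lengths of a plan are durations at speed 1, so a simulation of speed [spd] traverses the
    plan [spd] times faster than the clock. *)
Definition residual (spd : R) (st : sim) (t : R) : job N -> R :=
  plan_total (plan_after (current st) (spd * (t - clock st))).

Definition sim_rate (spd : R) (st : sim) (t : R) : job N -> R :=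
  plan_rate (current st) (spd * (t - clock st)).

(* The slack stays below [1 / #jobs] times the cost of any schedule on each of
   the jobs of positive weight that have arrived. *)
Definition arrival_slack (e : arrival) (b : R) : R :=
  if 0 < arr_weight e then
    Num.min b (arr_weight e * arr_size e / (rate_bound N * #|{: job N}|%:R))
  else b.

(** As long as the slack is positive the set given to [xget] is inhabited, and the default [[::]] is
    not reached. *)
Definition sim_step (spd : R) (st : sim) (e : arrival) : sim :=
  let x k := residual spd st (arr_time e) k +
             (if k == arr_job e then arr_size e else 0) in
  let rho k := if k == arr_job e then arr_weight e / arr_size e
               else density st k in
  let b := arrival_slack e (slack st) in
  Sim (arr_time e)
    (xget [::] [set L | plan_for x L /\ plan_cost rho 0 L <= opt_cost rho x + b])
    rho b.

(** The strict test makes a job released exactly at [t] part of the state at [t], in agreement with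
    [same_arrivals]. *)
Fixpoint state_at (spd : R) (st : sim) (es : seq arrival) (t : R) : sim :=
  if es is e :: es' then
    if t < arr_time e then st else state_at spd (sim_step spd st e) es' t
  else st.

Definition sim_init : sim := Sim 0 [::] (fun=> 0) 1.

Definition arrival_of (I : job_sequence N) (j : job N) : arrival :=
  Arrival j (release I j) (job_size I j) (weight I j).

Definition arrives_before (e e' : arrival) : bool := arr_time e <= arr_time e'.

Definition arrivals (I : job_sequence N) : seq arrival :=
  sort arrives_before [seq arrival_of I j | j <- enum {: job N}].

Definition job_order (I : job_sequence N) : seq (job N) :=
  sort (relpre (arrival_of I) arrives_before) (enum {: job N}).

Lemma arrivalsE I : arrivals I = [seq arrival_of I j | j <- job_order I].
Proof. by rewrite /arrivals sort_map. Qed.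

Lemma mem_job_order I j : j \in job_order I.
Proof. by rewrite mem_sort mem_enum. Qed.

Lemma job_order_uniq I : uniq (job_order I).
Proof. by rewrite sort_uniq enum_uniq. Qed.

Lemma job_order_sorted I :
  sorted (fun j k => release I j <= release I k) (job_order I).
Proof. by apply: sort_sorted => j k; exact: le_total. Qed.

Lemma state_at_filter spd st es t : sorted arrives_before es ->
  state_at spd st [seq e <- es | arr_time e <= t] t = state_at spd st es t.
Proof.
elim: es st => //= e es IH st pe; have [et|te] := leP (arr_time e) t.
  by rewrite /= ltNge et /= IH // (path_sorted pe).
suff -> : [seq e <- es | arr_time e <= t] = [::] by [].
elim: es e te pe {IH} => //= e' es IH e te /andP[ee' pe].
have te' : t < arr_time e' by exact: lt_le_trans te ee'.
by rewrite leNgt te' /= (IH e').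
Qed.

(** Filtering commutes with the stable sort, so the arrivals up to [t], ties included, come in an
    order that later jobs cannot influence. *)
Lemma state_at_arrivals_local spd (I I' : job_sequence N) t :
  same_arrivals t I I' ->
  state_at spd sim_init (arrivals I) t = state_at spd sim_init (arrivals I') t.
Proof.
have tot : total arrives_before by move=> e e'; exact: le_total.
have tr : transitive arrives_before by move=> ? ? ?; exact: le_trans.
move=> II'; rewrite -state_at_filter ?sort_sorted // -[RHS]state_at_filter ?sort_sorted //.
have fE J : [seq e <- [seq arrival_of J j | j <- enum {: job N}] | arr_time e <= t] =
    [seq arrival_of J j | j <- [seq j <- enum {: job N} | release J j <= t]].
  by rewrite filter_map.
congr state_at; rewrite /arrivals !filter_sort // !fE; congr sort.
rewrite [in LHS](@eq_filter _ _ (fun j => release I' j <= t)); last first.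
  move=> j /=; apply/idP/idP => h.
    by have [<-] := II' j (or_introl h).
  by have [->] := II' j (or_intror h).
apply/eq_in_map => j; rewrite mem_filter => /andP[/= h _].
by have [r p w] := II' j (or_intror h); rewrite /arrival_of r p w.
Qed.

End Simulation.

(** Replaces integrating a derivative: [m + 1] equal steps accumulate an error
    [K (b - a)^2 / (m + 1)], which tends to 0. *)
Lemma quadratic_error_le (R : realType) (G : R -> R) (a b K : R) : a <= b ->
  (forall t h, a <= t -> 0 <= h -> t + h <= b -> G (t + h) <= G t + K * h ^+ 2) ->
  G b <= G a.
Proof.
move=> ab Gstep; have K0 : 0 <= `|K| * (b - a) ^+ 2 by rewrite mulr_ge0 ?sqr_ge0.
have key m : G b <= G a + K * (b - a) ^+ 2 / m.+1%:R.
  pose h := (b - a) / m.+1%:R.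
  have m0 : (0 : R) < m.+1%:R by [].
  have h0 : 0 <= h by rewrite divr_ge0 // subr_ge0.
  have mh : m.+1%:R * h = b - a by rewrite /h mulrC divfK ?gt_eqF.
  have ind k : (k <= m.+1)%N -> G (a + k%:R * h) <= G a + k%:R * (K * h ^+ 2).
    elim: k => [_|k IH km]; first by rewrite !mul0r !addr0.
    have -> : a + k.+1%:R * h = a + k%:R * h + h by rewrite -natr1; ring.
    apply: (le_trans (Gstep (a + k%:R * h) h _ h0 _)).
    - by rewrite lerDl mulr_ge0.
    - have : k.+1%:R * h <= m.+1%:R * h by rewrite ler_wpM2r // ler_nat.
      by rewrite mh -natr1 mulrDl mul1r; lra.
    - by have := IH (ltnW km); rewrite -natr1; lra.
  have := ind m.+1 (leqnn _).
  rewrite mh subrKC => h1; apply: (le_trans h1); rewrite lerD2l.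
  by rewrite /h le_eqVlt; apply/orP; left; apply/eqP; field; rewrite addr_eq0 gt_eqF //.
apply/ler_addgt0Pr => e e0.
have [m mP] : exists m : nat, `|K| * (b - a) ^+ 2 / e < m.+1%:R.
  have X0 : 0 <= `|K| * (b - a) ^+ 2 / e by rewrite divr_ge0 // ltW.
  exists (Num.bound (`|K| * (b - a) ^+ 2 / e)).
  by apply: (lt_trans (archi_boundP X0)); rewrite ltr_nat.
apply: (le_trans (key m)); rewrite lerD2l ler_pdivrMr //.
apply: (@le_trans _ _ (`|K| * (b - a) ^+ 2)).
  by rewrite ler_wpM2r ?sqr_ge0 // ler_norm.
by move: mP; rewrite ltr_pdivrMr // => /ltW; rewrite [_ * e]mulrC.
Qed.

(** * Potential function argument *)

Section Potential.
Variables (R : realType) (V : finType) (N : network R V).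
Hypothesis adm : admissible N.
Variable I : job_sequence N.
Variables spd sg kap : R.
Hypotheses (sg0 : 0 <= sg) (sg_spd : sg <= spd) (kap0 : 0 <= kap).

Let p := job_size I.
Let w := weight I.
Let r := release I.
Let rho j := w j / p j.
Let p0 j : 0 < p j := job_size_gt0 I j.
Let w0 j : 0 <= w j := weight_ge0 I j.
Let rho0 j : 0 <= rho j. Proof. by rewrite divr_ge0 // ltW. Qed.
Let spd0 : 0 <= spd := le_trans sg0 sg_spd.
Let B := rate_bound N.
(** [k1] and [k2] are the coefficients of the drift. The factor [kap] in [k1] turns the fractional
    weight of the simulated queue into the full weight of the jobs not completed. *)
Let k1 := (spd - sg) / 2 * kap.
Let k2 := (spd + sg) / 2.

(** The cost of the plan being followed stands for [f x], so that between arrivals nothing is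
    required of the optimality of its remainder. *)
Definition potential (L : plan N) (y : job N -> R) : R :=
  plan_cost rho 0 L - opt_cost rho (fun j => plan_total L j + y j) / 2.

(** Its increments are weighted flow time: on a short interval it grows by the length times the
    weight of the jobs of [A] not completed. *)
Let done_by (A : pred (job N)) (C : job N -> R) t :=
  \sum_(j | A j) w j * Num.min t (C j).

Let dmin (t h c : R) : R := Num.min (t + h) c - Num.min t c.

Let dmin_bnd t h c : 0 <= h -> 0 <= dmin t h c <= h.
Proof.
by rewrite /dmin => h0; apply/andP; case: (leP (t + h) c); case: (leP t c) => ? ?;
  split; lra.
Qed.

Let dmin_past t h c : 0 <= h -> c <= t -> dmin t h c = 0.
Proof. by rewrite /dmin; case: (leP (t + h) c); case: (leP t c) => *; lra. Qed.

Let dmin_future t h c : 0 <= h -> t + h <= c -> dmin t h c = h.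
Proof. by rewrite /dmin; case: (leP (t + h) c); case: (leP t c) => *; lra. Qed.

Let done_step A C t h : done_by A C (t + h) - done_by A C t =
  \sum_(j | A j) w j * dmin t h (C j).
Proof. by rewrite /done_by -sumrB; apply: eq_bigr => j _; rewrite mulrBr. Qed.

(** The drift inequality between two arrivals. [A] stands for the jobs already arrived and [y] for
    the work the optimum has left on them. *)
Lemma potential_epoch (L : plan N) (a b : R) (y : R -> job N -> R)
    (A : pred (job N)) (CA CO : job N -> R) :
  valid_plan L -> a <= b ->
  (forall t t', a <= t -> t <= t' -> t' <= b ->
     scaled_rates (sg * (t' - t)) (fun j => y t j - y t' j)) ->
  (forall t j, a <= t -> t <= b -> 0 <= y t j <= p j) ->
  (forall t j, ~~ A j -> y t j = 0) ->
  (forall t j, t <= b -> A j -> CO j < t -> y t j = 0) ->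
  (forall t j, a <= t -> t < b -> A j -> t < CA j ->
     kap * p j <= plan_total (plan_after L (spd * (t - a))) j) ->
  potential (plan_after L (spd * (b - a))) (y b) +
    k1 * (done_by A CA b - done_by A CA a) <=
  potential L (y a) + k2 * (done_by A CO b - done_by A CO a).
Proof.
move=> vL ab y_rate y_bnd y_out y_done xA.
pose P t := plan_after L (spd * (t - a)).
pose x t := plan_total (P t).
pose G t := potential (P t) (y t) + k1 * done_by A CA t - k2 * done_by A CO t.
(* At unit speed the fractional weight changes at rate at most [D]. The quadratic error comes from
   replacing the weight of [x] at [t + h] by that at [t], and the weight of [y] at [t] by that at
   [t + h]. *)
pose D := B * \sum_j rho j.
suff : G b <= G a.
  rewrite /G /potential /P subrr mulr0 plan_after0 //.
  by rewrite plan_cost_after0 //; lra.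
apply: (@quadratic_error_le _ _ _ _ ((spd ^+ 2 + k2 * sg) * D) ab) => t h at_ h0 thb.
have th : t <= t + h by rewrite lerDl.
have ta0 : 0 <= spd * (t - a) by rewrite mulr_ge0 // subr_ge0.
have sh0 : 0 <= spd * h by rewrite mulr_ge0.
have vP : valid_plan (P t) by exact: valid_plan_after.
have PE : P (t + h) = plan_after (P t) (spd * h).
  by rewrite /P plan_after_after //; congr plan_after; ring.
have vP' : valid_plan (P (t + h)) by rewrite PE; exact: valid_plan_after.
have E1 : spd * h * dot rho (x (t + h)) + plan_cost rho 0 (P (t + h)) <=
    plan_cost rho 0 (P t) by rewrite /x PE; exact: plan_after_cost.
have xrate : scaled_rates (spd * h) (fun j => x t j - x (t + h) j).
  by rewrite /x PE; exact: plan_after_scaled.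
have yrate : scaled_rates (sg * h) (fun j => y t j - y (t + h) j).
  by have := y_rate t (t + h) at_ th thb; rewrite addrAC subrr add0r.
have shg0 : 0 <= sg * h by rewrite mulr_ge0.
have x0 t' j : valid_plan (P t') -> 0 <= x t' j by exact: plan_total_ge0.
have y0 j : 0 <= y (t + h) j.
  by case/andP: (y_bnd (t + h) j (le_trans at_ th) thb).
have E2 : opt_cost rho (fun j => x t j + y t j) <=
    (spd + sg) * h * (dot rho (x t) + dot rho (y t)) +
    opt_cost rho (fun j => x (t + h) j + y (t + h) j).
  rewrite -dotD; apply: opt_cost_step => //.
  - by rewrite mulr_ge0 // addr_ge0.
  - by move=> j; rewrite addr_ge0 // x0.
  - have [z Qz zE] := scaled_rates_add adm sh0 shg0 xrate yrate.
    by exists z => // j; rewrite mulrDl -zE; ring.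
have lip c (u u' : job N -> R) : 0 <= c -> scaled_rates c (fun j => u j - u' j) ->
    dot rho u <= dot rho u' + c * D.
  move=> c0 su; rewrite /D mulrA mulr_sumr -big_split /=.
  apply: ler_sum => j _; rewrite [_ * rho j]mulrC -mulrDr ler_wpM2l // -lerBlDl.
  exact: (scaled_rates_bounded j c0 su).
have E3 := lip _ _ _ sh0 xrate.
have E4 := lip _ _ _ shg0 yrate.
have rhop j : rho j * p j = w j by rewrite divfK ?gt_eqF.
(* The weight of [x] is taken at the start, where an uncompleted job still has [kap] of its size,
   and that of [y] at the end, where a job completed meanwhile has vanished. *)
have E5 : kap * (done_by A CA (t + h) - done_by A CA t) <= h * dot rho (x t).
  rewrite done_step !mulr_sumr [leRHS](bigID A) /= -[leLHS]addr0 lerD //; last first.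
    by apply: sumr_ge0 => j _; do !apply: mulr_ge0 => //; exact: x0.
  apply: ler_sum => j Aj; have /andP[m0 mh] := dmin_bnd t (CA j) h0.
  have -> : kap * (w j * dmin t h (CA j)) = rho j * (kap * p j * dmin t h (CA j)).
    by rewrite -rhop; ring.
  rewrite [leRHS]mulrCA; apply: ler_wpM2l => //.
  have [tC|Ct] := ltP t (CA j); last first.
    by rewrite dmin_past // mulr0; apply: mulr_ge0 => //; exact: x0.
  have [h00|hn0] := eqVneq h 0.
    have -> : dmin t h (CA j) = 0 by apply/eqP; rewrite eq_le m0 andbT -h00.
    by rewrite mulr0 h00 mul0r.
  have hp : 0 < h by rewrite lt_def hn0.
  have xj := xA t j at_ (lt_le_trans (ltr_pwDr hp (lexx t)) thb) Aj tC.
  by rewrite [leRHS]mulrC; apply: ler_pM => //; apply: mulr_ge0 => //; apply: ltW.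
have E6 : h * dot rho (y (t + h)) <= done_by A CO (t + h) - done_by A CO t.
  rewrite done_step mulr_sumr [leLHS](bigID A) /= -[leRHS]addr0 lerD //; last first.
    by apply: sumr_le0 => j nA; rewrite y_out // !mulr0.
  apply: ler_sum => j Aj; have /andP[m0 mh] := dmin_bnd t (CO j) h0.
  rewrite -rhop mulrCA -mulrA; apply: ler_wpM2l => //.
  have [Ct|tC] := ltP (CO j) (t + h).
    by rewrite y_done // mulr0 mulr_ge0 // ltW.
  rewrite dmin_future // mulrC.
  by rewrite ler_wpM2r //; case/andP: (y_bnd (t + h) j (le_trans at_ th) thb).
have F1 : spd * h * dot rho (x t) <= spd * h * (dot rho (x (t + h)) + spd * h * D).
  by rewrite ler_wpM2l.
have F2 : (spd + sg) / 2 * h * dot rho (y t) <=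
    (spd + sg) / 2 * h * (dot rho (y (t + h)) + sg * h * D).
  by rewrite ler_wpM2l // mulr_ge0 // divr_ge0 // addr_ge0.
have F3 : (spd - sg) / 2 * (kap * (done_by A CA (t + h) - done_by A CA t)) <=
    (spd - sg) / 2 * (h * dot rho (x t)).
  by rewrite ler_wpM2l // divr_ge0 // subr_ge0.
have F4 : (spd + sg) / 2 * (h * dot rho (y (t + h))) <=
    (spd + sg) / 2 * (done_by A CO (t + h) - done_by A CO t).
  by rewrite ler_wpM2l // divr_ge0 // addr_ge0.
rewrite /G /potential -/(x t) -/(x (t + h)) /k1 /k2.
move: E1 E2 F1 F2 F3 F4.
set c := plan_cost _ _ _; set c' := plan_cost _ _ _.
set o := opt_cost _ _; set o' := opt_cost _ _.
set dx := dot _ _; set dx' := dot _ _; set dy := dot _ _; set dy' := dot _ _.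
set a1 := done_by _ _ _; set a2 := done_by _ _ _.
set a3 := done_by _ _ _; set a4 := done_by _ _ _.
clear; move=> E1 E2 F1 F2 F3 F4; lra.
Qed.

(** [js] holds the jobs still to come. A list, not a comparison of releases with the clock, because
    jobs released at the same instant are handled one by one. *)
Definition sim_invariant (st : sim N) (js : seq (job N)) : Prop :=
  [/\ valid_plan (current st),
      forall j, j \in js -> plan_total (current st) j = 0,
      forall j, density st j = if j \in js then 0 else rho j,
      0 < slack st /\ (forall j, j \notin js -> 0 < w j ->
        slack st <= w j * p j / (B * #|{: job N}|%:R)) &
      0 <= clock st /\ (forall j, if j \in js then clock st <= r j
                                  else r j <= clock st)].

Let card_gt0 (j : job N) : 0 < B * #|{: job N}|%:R.
Proof.
rewrite mulr_gt0 ?rate_bound_gt0 // ltr0n; apply/card_gt0P.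
by exists j.
Qed.

Lemma sim_invariant_init : sim_invariant (sim_init N) (job_order I).
Proof.
split=> //.
- by move=> j; rewrite mem_job_order.
- by split=> // j; rewrite mem_job_order.
- by split=> // j; rewrite mem_job_order release_ge0.
Qed.

Lemma sim_step_invariant st j js : j \notin js ->
  (forall k, k \in js -> r j <= r k) -> sim_invariant st (j :: js) ->
  let st' := sim_step spd st (arrival_of I j) in
  [/\ sim_invariant st' js,
      forall k, plan_total (current st') k =
        residual spd st (r j) k + (if k == j then p j else 0) &
      forall beta, 0 <= beta ->
        (forall k, 0 < w k -> w k * p k / (B * #|{: job N}|%:R) <= beta) ->
        plan_cost rho 0 (current st') <=
        opt_cost rho (plan_total (current st')) + beta].
Proof.
move=> jjs jmin [vL L0 dE [s0 sP] [c0 cr]] st'.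
set rho' := density st'; set b := slack st'.
have cj : clock st <= r j by have := cr j; rewrite inE eqxx.
have d0 : 0 <= spd * (r j - clock st) by rewrite mulr_ge0 // subr_ge0.
have res0 k : 0 <= residual spd st (r j) k.
  by apply: plan_total_ge0; exact: valid_plan_after.
have resj k : k \in j :: js -> residual spd st (r j) k = 0.
  move=> kj; apply/eqP; rewrite eq_le res0 andbT -(L0 _ kj) -subr_ge0.
  exact: (scaled_rates_ge0 k d0 (plan_after_scaled adm d0 vL)).
pose x k := residual spd st (r j) k + (if k == j then p j else 0).
have x0 k : 0 <= x k by rewrite addr_ge0 //; case: ifP => // _; exact: ltW.
have rhoE k : rho' k = if k \in js then 0 else rho k.
  rewrite /rho' /= dE inE; have [->|kj] //= := eqVneq k j.
  by rewrite (negbTE jjs).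
have rho'0 k : 0 <= rho' k by rewrite rhoE; case: ifP.
have b0 : 0 < b.
  rewrite /b /= /arrival_slack /=; case: ifP => // wj.
  by rewrite lt_min s0 /= divr_gt0 ?card_gt0 // mulr_gt0.
have bP k : k \notin js -> 0 < w k -> b <= w k * p k / (B * #|{: job N}|%:R).
  move=> kjs wk; rewrite /b /= /arrival_slack /=; have [kj|kj] := eqVneq k j.
    by move: wk; rewrite kj => -> /=; rewrite ge_min lexx orbT.
  have h : slack st <= w k * p k / (B * #|{: job N}|%:R).
    by apply: sP => //; rewrite inE negb_or kj.
  by case: ifP => // _; rewrite ge_min h.
have [[vL' L'E] L'cost] : plan_for x (current st') /\
    plan_cost rho' 0 (current st') <= opt_cost rho' x + b.
  have [L xL Lc] := opt_cost_approx adm rho'0 x0 b0.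
  rewrite /st' /sim_step /=; set S := [set L | _].
  suff : S (xget [::] S) by [].
  by apply: xgetPex; exists L; split=> //; exact: ltW.
split.
- split=> //.
  + move=> k kjs; rewrite L'E /x resj ?inE ?kjs ?orbT // add0r.
    by case: eqP kjs jjs => // -> ->.
  + split=> [|k]; first exact: le_trans cj.
    case: ifP => kjs; first exact: jmin.
    have := cr k; rewrite inE; case: eqP => [->//|_].
    by rewrite kjs /= => /le_trans; apply.
- by move=> k; exact: L'E.
move=> beta beta0 betaP.
have supp k : rho k = rho' k \/ plan_total (current st') k = 0.
  rewrite rhoE; case: ifP => kjs; [right|by left].
  rewrite L'E /x resj ?inE ?kjs ?orbT // add0r.
  by case: eqP kjs jjs => // -> ->.
rewrite (plan_cost_support 0 vL' supp) (opt_cost_support supp).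
rewrite (eq_opt_cost _ L'E).
(* If every arrived job has weight 0, the slack need not be below [beta], but then the plan costs
   0. *)
have [[k kjs wk]|nw] := pselect (exists2 k, k \notin js & 0 < w k).
  by rewrite (le_trans L'cost) // lerD2l (le_trans (bP k kjs wk)) // betaP.
have rho'E k : rho' k = 0.
  rewrite rhoE; case: ifPn => // kjs; apply/eqP; rewrite mulf_eq0; apply/orP; left.
  rewrite eq_le w0 andbT leNgt; apply/negP => wk; apply: nw; exists k => //.
have -> : plan_cost rho' 0 (current st') = 0.
  have -> : rho' = fun=> 0 by apply/funext.
  suff H L t : plan_cost (fun _ : job N => 0 : R) t L = 0 by exact: H.
  elim: L t => //= s L IH t; rewrite IH /dot big1 ?mulr0 ?addr0 //.
  by move=> k _; rewrite mul0r.
by rewrite addr_ge0 // opt_cost_ge0.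
Qed.

Variable Y : R -> job N -> R.
Variables CA CO : job N -> R.
Hypothesis Y_rate : forall t t', 0 <= t -> t <= t' ->
  scaled_rates (sg * (t' - t)) (fun j => if r j <= t then Y t j - Y t' j else 0).
Hypothesis Y_bnd : forall t j, r j <= t -> 0 <= Y t j <= p j.
Hypothesis Y_release : forall j, Y (r j) j = p j.
Hypothesis Y_done : forall t j, CO j < t -> Y t j = 0.
Hypothesis CA_ge : forall j, r j <= CA j.
Hypothesis CO_ge : forall j, r j <= CO j.

Let Ym (js : seq (job N)) t j := if j \in js then 0 else Y t j.
(** The weighted flow time still to be paid from the state [st] on. *)
Let todo (C : job N -> R) (st : sim N) (js : seq (job N)) : R :=
  \sum_j w j * (C j - (if j \in js then r j else Num.min (clock st) (C j))).

Let todo_step C st j js : j \notin js -> (forall k, r k <= C k) ->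
  todo C st (j :: js) =
  todo C (sim_step spd st (arrival_of I j)) js +
  (done_by (fun k => k \notin j :: js) C (r j) -
   done_by (fun k => k \notin j :: js) C (clock st)).
Proof.
move=> jjs rC; rewrite /done_by -sumrB /todo.
rewrite [X in _ = _ + X]big_mkcond /= -big_split /=.
apply: eq_bigr => k _; rewrite inE; have [->|kj] /= := eqVneq k j.
  by rewrite (negbTE jjs) min_l // addr0.
by case: ifP => _ /=; ring.
Qed.

(** Induction on the jobs to come: each round joins the epoch before the next arrival, the jump at
    it (at most [beta]), and the claim for the new state. *)
Lemma potential_bound beta st js : uniq js ->
  sorted (fun j k => r j <= r k) js -> sim_invariant st js -> 0 <= beta ->
  (forall k, 0 < w k -> w k * p k / (B * #|{: job N}|%:R) <= beta) ->
  (forall t j, clock st <= t -> r j <= t -> t < CA j ->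
     kap * p j <= residual spd
       (state_at spd st [seq arrival_of I k | k <- js] t) t j) ->
  k1 * todo CA st js <=
  potential (current st) (Ym js (clock st)) + k2 * todo CO st js +
  (size js)%:R * beta.
Proof.
move=> + + + beta0 betaP.
have Ym_rate c ks t t' : 0 <= c -> (forall j, j \notin ks -> r j <= c) ->
    c <= t -> t <= t' ->
    scaled_rates (sg * (t' - t)) (fun j => Ym ks t j - Ym ks t' j).
  move=> c0 rc ct tt'.
  have h : 0 <= sg * (t' - t) by rewrite mulr_ge0 // subr_ge0.
  have hY := Y_rate (le_trans c0 ct) tt'.
  apply: (scaled_rates_le adm h hY) => j; rewrite /Ym.
  have := scaled_rates_ge0 j h hY; case: (boolP (j \in ks)) => [_|ks_j] /=.
    by rewrite subrr lexx => ->.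
  by rewrite (le_trans (rc _ ks_j) ct) => ->; rewrite lexx.
have Ym_bnd c ks t j : (forall j, j \notin ks -> r j <= c) -> c <= t ->
    0 <= Ym ks t j <= p j.
  move=> rc ct; rewrite /Ym; case: ifPn => [_|ks_j]; first by rewrite lexx ltW.
  by apply: Y_bnd; exact: le_trans (rc _ ks_j) ct.
elim: js st => [|j js IH] st.
  move=> _ _ [vL _ _ _ [c0 cr]] /= xA; rewrite mul0r addr0.
  (* A time after all completions, where the whole flow time has been paid. *)
  pose T := clock st + \sum_j (`|CA j| + `|CO j|) + 1.
  have TE (C : job N -> R) : (forall j, `|C j| <= `|CA j| + `|CO j|) -> forall j, C j < T.
    move=> CP j; rewrite /T -addrA; apply: (le_lt_trans (ler_norm _)).
    rewrite addrA ltr_pwDr // (le_trans (CP j)) // ler_wpDl // (bigD1 j) //= lerDl.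
    by apply: sumr_ge0 => k _; rewrite addr_ge0.
  have TA : forall j, CA j < T by apply: TE => j; rewrite lerDl.
  have TO : forall j, CO j < T by apply: TE => j; rewrite lerDr.
  have cT : clock st <= T.
    by rewrite /T -addrA lerDl addr_ge0 // sumr_ge0 // => k _; rewrite addr_ge0.
  have rc k : k \notin [::] -> r k <= clock st by move=> _; exact: cr k.
  have h := @potential_epoch (current st) (clock st) T (Ym [::])
    (fun k => k \notin [::]) CA CO vL cT
    (fun t t' h1 h2 h3 => Ym_rate _ _ t t' c0 rc h1 h2)
    (fun t j h1 h2 => Ym_bnd _ _ t j rc h1).
  have {h} := h _ _ _.
  rewrite /done_by; set e1 := (X in potential X _ + _) => h.
  have {h} : potential e1 (Ym [::] T) + k1 * todo CA st [::] <=
      potential (current st) (Ym [::] (clock st)) + k2 * todo CO st [::].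
    have tE C : (forall j, C j < T) -> todo C st [::] =
        \sum_(j | j \notin [::]) w j * Num.min T (C j) -
        \sum_(j | j \notin [::]) w j * Num.min (clock st) (C j).
      move=> CT; rewrite -sumrB /todo; apply: eq_big => // k _.
      by rewrite /= [Num.min T _]min_r ?ltW // mulrBr.
    rewrite (tE CA) // (tE CO) //; apply: h => //.
    - by move=> t k _ _; exact: Y_done.
    - by move=> t k ct tT _ tC; apply: xA => //; exact: le_trans (cr k) ct.
  apply: le_trans; rewrite lerDr.
  have d0 : 0 <= spd * (T - clock st) by rewrite mulr_ge0 // subr_ge0.
  have vP : valid_plan e1 by exact: valid_plan_after.
  (* At [T] the optimum has no work left, so the potential is a plan cost minus half of a smaller
     optimum, hence nonnegative. *)
  rewrite /potential (@eq_opt_cost _ _ _ rho _ (plan_total e1)); last first.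
    by move=> k; rewrite /Ym /= Y_done // addr0.
  have := opt_cost_ge0 adm rho0 (fun j => plan_total_ge0 j vP).
  have := @opt_cost_le _ _ _ rho rho0 (plan_total e1) e1 (conj vP (fun=> erefl)).
  lra.
cbn [uniq]; case/andP=> jjs ujs sjs inv xA.
have jmin k : k \in js -> r j <= r k.
  have tr : transitive (fun j k => r j <= r k) by move=> ? ? ?; exact: le_trans.
  by have /allP h := order_path_min tr sjs; exact: h.
have [vL L0 dE sl [c0 cr]] := inv.
have [inv' totE costE] := sim_step_invariant jjs jmin inv.
set st' := sim_step _ _ _ in inv' totE costE.
have cj : clock st <= r j by have := cr j; rewrite inE eqxx.
have rc k : k \notin j :: js -> r k <= clock st.
  by move=> kj; have := cr k; rewrite (negbTE kj).
have ep : potential (plan_after (current st) (spd * (r j - clock st)))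
    (Ym (j :: js) (r j)) +
    k1 * (done_by (fun k => k \notin j :: js) CA (r j) -
          done_by (fun k => k \notin j :: js) CA (clock st)) <=
    potential (current st) (Ym (j :: js) (clock st)) +
    k2 * (done_by (fun k => k \notin j :: js) CO (r j) -
          done_by (fun k => k \notin j :: js) CO (clock st)).
  apply: potential_epoch => //.
  - by move=> t t' h1 h2 h3; exact: Ym_rate h1 h2.
  - by move=> t k h1 h2; exact: Ym_bnd h1.
  - by move=> t k; rewrite /Ym negbK => ->.
  - by move=> t k _ kj Ct; rewrite /Ym (negbTE kj) Y_done.
  - move=> t k ct tr kj tC; have := xA t k ct (le_trans (rc k kj) ct) tC.
    by rewrite /= tr.
have IH' : k1 * todo CA st' js <= potential (current st') (Ym js (r j)) +
    k2 * todo CO st' js + (size js)%:R * beta.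
  apply: IH => //; first exact: path_sorted sjs.
  move=> t k rt rk tC; have := xA t k (le_trans cj rt) rk tC.
  by rewrite /= ltNge rt.
have d0 : 0 <= spd * (r j - clock st) by rewrite mulr_ge0 // subr_ge0.
have jump : potential (current st') (Ym js (r j)) <=
    potential (plan_after (current st) (spd * (r j - clock st)))
      (Ym (j :: js) (r j)) + beta.
  set L1 := plan_after _ _.
  have vL1 : valid_plan L1 by exact: valid_plan_after.
  pose e k := if k == j then p j else 0.
  have e0 k : 0 <= e k by rewrite /e; case: ifP => // _; exact: ltW.
  have u k : plan_total L1 k <= plan_total L1 k + Ym (j :: js) (r j) k.
    by rewrite lerDl; have /andP[] := Ym_bnd _ _ (r j) k rc cj.
  have := opt_cost_arrival adm rho0 (fun k => plan_total_ge0 k vL1) u e0.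
  have := @opt_cost_le _ _ _ rho rho0 (plan_total L1) L1 (conj vL1 (fun=> erefl)).
  have := costE _ beta0 betaP.
  rewrite (eq_opt_cost _ totE).
  rewrite /potential (@eq_opt_cost _ _ _ rho (fun k => plan_total (current st') k + _)
    (fun k => plan_total L1 k + Ym (j :: js) (r j) k + e k + e k)); last first.
    move=> k; rewrite totE /residual -/L1 /Ym /e inE; have [->|_] /= := eqVneq k j.
      by rewrite (negbTE jjs) Y_release; ring.
    by ring.
  rewrite /residual -/L1 /e; lra.
rewrite (todo_step _ jjs CA_ge) (todo_step _ jjs CO_ge) -/st'.
rewrite /= -natr1; move: ep IH' jump.
set a1 := done_by _ _ _; set a2 := done_by _ _ _.
set a3 := done_by _ _ _; set a4 := done_by _ _ _.
lra.
Qed.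

(** The potential starts nonpositive. Each arrival loses at most [beta = SO / n], because a job of
    positive weight costs the optimum at least [w j * p j / B]; the [n] arrivals lose at most [SO],
    which is the [+ 1]. *)
Lemma total_flow_bound :
  (forall j, p j <= B * (CO j - r j)) ->
  (forall t j, r j <= t -> t < CA j ->
     kap * p j <= residual spd (state_at spd (sim_init N) (arrivals I) t) t j) ->
  k1 * \sum_j w j * (CA j - r j) <= (k2 + 1) * \sum_j w j * (CO j - r j).
Proof.
move=> CO_p xA; set SO := \sum_j w j * (CO j - r j).
have SO0 : 0 <= SO by apply: sumr_ge0 => j _; rewrite mulr_ge0 // subr_ge0.
pose n := #|{: job N}|%:R : R.
have n0 : 0 <= n by [].
have todoE C : todo C (sim_init N) (job_order I) = \sum_j w j * (C j - r j).
  by apply: eq_bigr => j _; rewrite mem_job_order.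
have := @potential_bound (SO / n) (sim_init N) (job_order I) (job_order_uniq I)
  (job_order_sorted I) sim_invariant_init.
rewrite !todoE -/SO => h; apply: (le_trans (h _ _ _)).
- by rewrite divr_ge0.
- move=> k wk; have B0 : 0 < B := rate_bound_gt0 N.
  rewrite -/n invfM mulrA ler_wpM2r ?invr_ge0 // ler_pdivrMr //.
  rewrite (le_trans (ler_wpM2l (w0 k) (CO_p k))) // mulrCA mulrC ler_wpM2r ?(ltW B0) //.
  rewrite /SO (bigD1 k) //= lerDl.
  by apply: sumr_ge0 => j _; rewrite mulr_ge0 // subr_ge0.
- by move=> t j _ rt tC; rewrite -arrivalsE; exact: xA.
have -> : (size (job_order I))%:R = n by rewrite size_sort -cardT.
have nS : n * (SO / n) <= SO.
  have [->|nn0] := eqVneq n 0; first by rewrite mul0r.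
  by rewrite mulrCA divff // mulr1.
have : potential (current (sim_init N)) (Ym (job_order I) (clock (sim_init N))) <= 0.
  rewrite /potential /= sub0r oppr_le0 divr_ge0 // opt_cost_ge0 // => j.
  by rewrite /Ym mem_job_order addr0.
by rewrite mulrDl mul1r; move: nS; set u := n * _; lra.
Qed.

End Potential.

(** * Work as an integral *)

Section Work.
Variable R : realType.
Implicit Types (g h : R -> R) (a b c : R).

Definition work g a b : \bar R := (\int[lebesgue_measure]_(x in `[a, b]) (g x)%:E)%E.

Definition tame (B : R) g : Prop :=
  measurable_fun (`[0, +oo[%classic : set (measurableTypeR R)) g /\
  forall t, 0 <= t -> 0 <= g t <= B.



Lemma sub_halfline a b : 0 <= a ->
  (`[a, b]%classic : set R) `<=` (`[0, +oo[%classic : set R).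
Proof.
by move=> a0 x /=; rewrite !in_itv /= andbT => /andP[ax _]; exact: le_trans ax.
Qed.

Lemma tame_measurable B g a b : tame B g -> 0 <= a ->
  measurable_fun (`[a, b]%classic : set (measurableTypeR R)) (EFin \o g).
Proof.
move=> [mg _] a0; apply/measurable_EFinP.
by apply: measurable_funS mg => //; exact: sub_halfline.
Qed.

Lemma tame_ge0 B g a b x : tame B g -> 0 <= a -> (`[a, b]%classic : set R) x -> (0 <= (g x)%:E)%E.
Proof.
move=> [_ gB] a0 /= ; rewrite in_itv /= lee_fin => /andP[ax _].
by case/andP: (gB x (le_trans a0 ax)).
Qed.

Lemma work_le B B' g h a b : tame B g -> tame B' h -> 0 <= a ->
  (forall x, a <= x <= b -> g x <= h x) -> (work g a b <= work h a b)%E.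
Proof.
move=> tg th a0 gh; apply: ge0_le_integral => //.
- by move=> x; exact: tame_ge0 tg a0.
- exact: tame_measurable tg a0.
- exact: tame_measurable th a0.
Qed.

Lemma work_ge0 B g a b : tame B g -> 0 <= a -> (0 <= work g a b)%E.
Proof. by move=> tg a0; apply: integral_ge0 => x; exact: tame_ge0 tg a0. Qed.

Lemma work_cst c a b : a <= b -> work (fun=> c) a b = (c * (b - a))%:E.
Proof.
move=> ab; rewrite /work integral_cst //= lebesgue_measure_itv /= lte_fin.
case: ltP => [_|ba]; first by rewrite -EFinB -EFinM.
by rewrite mule0 (_ : b = a) ?subrr ?mulr0 //; apply/eqP; rewrite eq_le ab ba.
Qed.

Lemma tame_cst c : 0 <= c -> tame c (fun=> c).
Proof. by move=> c0; split=> [|t _]; [exact: measurable_cst|rewrite c0 lexx]. Qed.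

Lemma work_bounded B g a b : 0 <= B -> tame B g -> 0 <= a -> a <= b ->
  (work g a b <= (B * (b - a))%:E)%E.
Proof.
move=> B0 tg a0 ab; rewrite -work_cst //; apply: (work_le tg (tame_cst B0) a0).
by move=> x /andP[ax _]; case/andP: (tg.2 x (le_trans a0 ax)).
Qed.

Lemma work_fin_num B g a b : tame B g -> 0 <= a -> work g a b \is a fin_num.
Proof.
move=> tg a0; have B0 : 0 <= B by case/andP: (tg.2 0 (lexx _)); exact: le_trans.
rewrite ge0_fin_numE ?(work_ge0 _ tg) //; have [ab|ba] := leP a b.
  by rewrite (le_lt_trans (work_bounded B0 tg a0 ab)) // ltry.
by rewrite /work set_itv_ge ?integral_set0 // bnd_simp -ltNge.
Qed.

Lemma work_split B g a b c : tame B g -> 0 <= a -> a <= b -> b <= c ->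
  work g a c = (work g a b + work g b c)%E.
Proof.
move=> tg a0 ab bc; rewrite /work.
have -> : (`[a, c]%classic : set R) = `[a, b[%classic `|` `[b, c]%classic.
  by rewrite -itv_bndbnd_setU // bnd_simp.
have mab : measurable_fun (`[a, b[%classic : set (measurableTypeR R)) (EFin \o g).
  apply: measurable_funS (tame_measurable (b := b) tg a0) => //.
  by move=> x /=; rewrite !in_itv /= => /andP[-> /ltW].
rewrite ge0_integral_setU //; first by rewrite integral_itv_bndo_bndc.
- rewrite (_ : _ `|` _ = `[a, c]%classic); first exact: tame_measurable tg a0.
  by rewrite -itv_bndbnd_setU // bnd_simp.
- move=> x; rewrite -itv_bndbnd_setU ?bnd_simp //; exact: tame_ge0 tg a0.
- apply/eqP; rewrite -subset0 => x /= []; rewrite !in_itv /= => /andP[_ xb] /andP[bx _].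
  by move: (lt_le_trans xb bx); rewrite ltxx.
Qed.

(** The right endpoint is excluded because rates switch there, at an arrival or at the end of a plan
    step. *)
Lemma work_eq_itvco B g h a b : tame B g -> tame B h -> 0 <= a ->
  (forall x, a <= x < b -> g x = h x) -> work g a b = work h a b.
Proof.
move=> tg th a0 gh; rewrite /work.
have m (f : R -> R) : tame B f ->
    measurable_fun (`[a, b[%classic : set (measurableTypeR R)) (EFin \o f).
  move=> tf; apply: measurable_funS (tame_measurable (b := b) tf a0) => //.
  by move=> x /=; rewrite !in_itv /= => /andP[-> /ltW].
rewrite -[LHS]integral_itv_bndo_bndc; last exact: m.
rewrite -[RHS]integral_itv_bndo_bndc; last exact: m.
by apply: eq_integral => x; rewrite inE /= in_itv /= => /gh ->.
Qed.

End Work.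

(** * Averages of feasible rates *)

Lemma sum_indic_work (R : realType) (I : finType) (E : I -> set R) (al : I -> R)
    (a b : R) :
  (forall i, measurable (E i : set (measurableTypeR R))) ->
  (forall i, E i `<=` `[a, b]%classic) -> (forall i, 0 <= al i) ->
  work (fun t => \sum_i al i * \1_(E i) t) a b =
  (\sum_i al i * fine (lebesgue_measure (E i)))%:E.
Proof.
move=> mE Eab al0; rewrite /work.
under eq_integral do rewrite -sumEFin.
rewrite ge0_integral_sum //; last first.
- by move=> i x _; rewrite lee_fin mulr_ge0 // indicE.
- by move=> i; apply/measurable_EFinP; apply: measurable_funM => //; exact: measurable_indic.
rewrite -sumEFin; apply: eq_bigr => i _.
under eq_integral do rewrite EFinM.
rewrite ge0_integralZl_EFin //; last first.
  by apply/measurable_EFinP; exact: measurable_indic.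
rewrite integral_indic // setIidl // EFinM; congr (_ * _)%E.
rewrite fineK // ge0_fin_numE // (@le_lt_trans _ _ (lebesgue_measure (`[a, b]%classic : set R))) //.
  by apply: le_measure; rewrite ?inE; [exact: mE|exact: measurable_itv|exact: Eab].
by rewrite lebesgue_measure_itv /=; case: ifP => // _; rewrite -EFinB ltry.
Qed.

Section Averaging.
Variables (R : realType) (V : finType) (N : network R V).
Hypothesis adm : admissible N.

Lemma scaled_rates0 : @scaled_rates R V N 0 (fun=> 0).
Proof. by exists (fun=> 0) => [|j]; [exact: feasible_rates0|rewrite mulr0]. Qed.

Lemma scaled_rates_sum (I : Type) (s : seq I) (m : I -> R) (q : I -> job N -> R) :
  (forall i, 0 <= m i) -> (forall i, @scaled_rates R V N (m i) (q i)) ->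
  @scaled_rates R V N (\sum_(i <- s) m i) (fun j => \sum_(i <- s) q i j).
Proof.
move=> m0 mq; elim: s => [|i s [z Qz zE]].
  by have [z Qz zE] := scaled_rates0; exists z => // j; rewrite !big_nil; exact: zE.
have s0 : 0 <= \sum_(k <- s) m k by rewrite sumr_ge0.
have [z' Qz' z'E] := scaled_rates_add adm (m0 i) s0 (mq i) (ex_intro2 _ _ z Qz zE).
by exists z' => // j; rewrite !big_cons z'E.
Qed.

Lemma scaled_rates_widen s t (a : job N -> R) : 0 <= s <= t ->
  @scaled_rates R V N s a -> @scaled_rates R V N t a.
Proof.
move=> /andP[s0 st] sa.
have ts : 0 <= t - s by rewrite subr_ge0.
have t0 : @scaled_rates R V N (t - s) (fun=> 0).
  by exists (fun=> 0) => [|j]; [exact: feasible_rates0|rewrite mulr0].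
have [z Qz zE] := scaled_rates_add adm s0 ts sa t0.
by exists z => // j; rewrite -[LHS]addr0 zE subrKC.
Qed.

(* Rounding the rates down to multiples of [1/n] makes the average a finite
   convex combination of feasible rates; the rounding error is absorbed by
   a small multiple of a positive feasible rate vector. *)
Lemma scaled_rates_work (z : schedule N) (theta a b : R) :
  (forall j, tame (rate_bound N) (fun t => z t j)) ->
  (forall t, 0 <= t -> feasible_rates (z t)) -> 0 < theta -> 0 <= a -> a <= b ->
  @scaled_rates R V N ((1 + theta) * (b - a)) (fun j => fine (work (fun t => z t j) a b)).
Proof.
move=> tz Qz th0 a0 ab; have [z0 Qz0 z0P] := positive_feasible_rates adm.
have ba0 : 0 <= b - a by rewrite subr_ge0.
pose X := \sum_j (theta * z0 j)^-1.
have X0 : 0 <= X by apply: sumr_ge0 => j _; rewrite invr_ge0 mulr_ge0 // ltW.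
(* Large enough for the rounding error [1 / n] to be at most [theta * z0 j] for every [j]. *)
pose n : R := (Num.truncn X).+1%:R.
have n0 : 0 < n by rewrite ltr0n.
have nz j : n^-1 <= theta * z0 j.
  rewrite -[leRHS]invrK lef_pV2 ?posrE ?invr_gt0 ?mulr_gt0 //.
  rewrite (le_trans _ (ltW (truncnS_gt X))) // /X (bigD1 j) //= lerDl.
  by apply: sumr_ge0 => k _; rewrite invr_ge0 mulr_ge0 // ltW.
pose K := (Num.truncn (n * rate_bound N)).+1.
pose C := {ffun job N -> 'I_K}.
(* Times at which [n * z t j] has integer part [c j] for all [j]; since rates are bounded, finitely
   many such cells cover the interval. *)
pose E (c : C) := [set t | `[a, b]%classic t /\
  forall j, (c j)%:R <= n * z t j < (c j).+1%:R].
have pos t : `[a, b]%classic t -> 0 <= t.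
  by rewrite /= in_itv /= => /andP[at_ _]; exact: le_trans at_.
have nz0 t j : 0 <= t -> 0 <= n * z t j.
  by move=> t0; rewrite mulr_ge0 ?(Qz _ t0).2 // ltW.
have mE c : measurable (E c : set (measurableTypeR R)).
  have -> : E c = `[a, b]%classic `&` \bigcap_(j in [set: job N])
      (`[a, b]%classic `&` (fun t => z t j) @^-1` `[(c j)%:R / n, (c j).+1%:R / n[%classic).
    apply/seteqP; split=> t /= [abt h]; split=> // j.
      move=> _; split=> //=; rewrite in_itv /= ler_pdivrMr // ltr_pdivlMr //.
      by rewrite ![_ * n]mulrC.
    have [_ /=] := h j I; rewrite in_itv /= ler_pdivrMr // ltr_pdivlMr //.
    by rewrite ![_ * n]mulrC.
  apply: measurableI => //; apply: fin_bigcap_measurable => // j _.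
  have mz : measurable_fun (`[a, b]%classic : set (measurableTypeR R)) (fun t => z t j).
    by apply: measurable_funS (tz j).1 => //; exact: sub_halfline.
  exact: mz.
have Eab c : E c `<=` `[a, b]%classic by move=> t [].
have cell t : `[a, b]%classic t -> exists c, E c t.
  move=> abt; exists [ffun j => inord (Num.truncn (n * z t j))]; split=> // j.
  rewrite ffunE inordK; first exact/truncn_itv/nz0/pos.
  rewrite ltnS le_truncn // ler_wpM2l ?(ltW n0) //.
  by apply: feasible_rates_bounded; exact/Qz/pos.
have cell_uniq t c c' : E c t -> E c' t -> c = c'.
  move=> [_ h] [_ h']; apply/ffunP => j; apply: val_inj => /=.
  by rewrite -(truncn_def (h j)) -(truncn_def (h' j)).
have indic1 t : `[a, b]%classic t -> \sum_c \1_(E c) t = 1 :> R.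
  move=> abt; have [c Ect] := cell t abt; rewrite (bigD1 c) //= big1 ?addr0.
    by rewrite indicE mem_set.
  move=> c' c'c; rewrite indicE memNset // => Ec't.
  by rewrite (cell_uniq _ _ _ Ect Ec't) eqxx in c'c.
pose m c := fine (lebesgue_measure (E c)).
have m0 c : 0 <= m c by apply: fine_ge0.
have meas_simple (al : C -> R) :
    measurable_fun (`[0, +oo[%classic : set (measurableTypeR R))
      (fun t => \sum_c al c * \1_(E c) t).
  apply: measurable_sum => c; apply: measurable_funM => //.
have tame_simple (al : C -> R) : (forall c, 0 <= al c) ->
    tame (\sum_c al c) (fun t => \sum_c al c * \1_(E c) t).
  move=> al0; split=> [|t _]; first exact: meas_simple.
  rewrite sumr_ge0 => [|c _]; last by rewrite mulr_ge0 // indicE.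
  by apply: ler_sum => c _; rewrite ler_piMr // indicE; case: (_ \in _).
have msum : \sum_c m c <= b - a.
  rewrite -[b - a]mul1r -lee_fin -work_cst // -[X in (X%:E <= _)%E](eq_bigr _ (fun c _ => mul1r (m c))).
  rewrite -(sum_indic_work mE Eab (fun=> ler01)).
  apply: (work_le (tame_simple (fun=> 1) (fun=> ler01)) (tame_cst ler01)) => //.
  move=> t abt; under eq_bigr do rewrite mul1r.
  by rewrite indic1 //= in_itv.
pose q (c : C) (j : job N) : R := m c * ((c j)%:R / n).
have qS c : @scaled_rates R V N (m c) (q c).
  (* On a nonempty cell the rounded rates lie below actual feasible rates; an empty cell has measure
     0. *)
  have [[t Ect]|nE] := pselect (exists t, E c t).
    exists (fun j => (c j)%:R / n) => //.
    apply: (feasible_rates_le adm (Qz t (pos t Ect.1))) => j.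
    rewrite divr_ge0 ?(ltW n0) //= ler_pdivrMr // mulrC.
    by have /andP[] := Ect.2 j.
  have mc0 : m c = 0.
    rewrite /m (_ : E c = set0) ?measure0 //.
    by apply/seteqP; split=> // t Ect; apply: nE; exists t.
  exists (fun=> 0) => [|j]; first exact: feasible_rates0.
  by rewrite /q mc0 !mul0r.
have S1 := scaled_rates_widen (introT andP (conj (sumr_ge0 _ (fun c _ => m0 c)) msum))
  (scaled_rates_sum (index_enum C) m0 qS).
have S2 : @scaled_rates R V N (theta * (b - a)) (fun j => theta * (b - a) * z0 j).
  by exists z0.
have tb0 : 0 <= theta * (b - a) by rewrite mulr_ge0 // ltW.
have S3 := scaled_rates_add adm ba0 tb0 S1 S2.
have -> : (1 + theta) * (b - a) = b - a + theta * (b - a) by ring.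
apply: (scaled_rates_le adm _ S3) => [|j]; first by rewrite addr_ge0.
rewrite fine_ge0 ?(work_ge0 _ (tz j)) //=.
have al0 (c : C) : 0 <= (c j).+1%:R / n by rewrite divr_ge0 // ltW.
have : (work (fun t => z t j) a b <= (\sum_(c : C) ((c j).+1%:R / n) * m c)%:E)%E.
  rewrite -(@sum_indic_work _ _ E (fun c : C => (c j).+1%:R / n) a b mE Eab al0).
  apply: (work_le (tz j) (tame_simple (fun c : C => (c j).+1%:R / n) al0)) => // t abt.
  have [c Ect] : exists c, E c t by apply: cell; rewrite /= in_itv.
  rewrite (bigD1 c) //= indicE mem_set // mulr1 -[leLHS]addr0 lerD //.
    rewrite ler_pdivlMr // mulrC; by have /andP[_ /ltW] := Ect.2 j.
  by apply: sumr_ge0 => c' _; rewrite mulr_ge0 // indicE.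
rewrite -[X in (X <= _)%E]fineK ?(work_fin_num _ (tz j)) // lee_fin => /le_trans; apply.
have -> : \sum_(c : C) (c j).+1%:R / n * m c =
    \sum_(c : C) q c j + (\sum_c m c) / n.
  rewrite mulr_suml -big_split /=; apply: eq_bigr => c _.
  by rewrite /q -natr1; ring.
rewrite lerD2l (le_trans (ler_wpM2r _ msum)) ?invr_ge0 ?(ltW n0) //.
by rewrite [theta * _]mulrC -mulrA ler_wpM2l.
Qed.

End Averaging.

(** * Completion times and the work of the simulation *)

Section Completion.
Variables (R : realType) (V : finType) (N : network R V).
Variables (I : job_sequence N) (z : schedule N) (B : R).
Hypothesis tz : forall j, tame B (fun t => z t j).
Hypothesis cz : forall j, (completion I z j < +oo)%E.

Let C j := fine (completion I z j).

Let processedE j t : processed I z j t = work (fun x => z x j) (release I j) t.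
Proof. by []. Qed.

Let processed_early j t : ((job_size I j)%:E <= processed I z j t)%E ->
  release I j <= t.
Proof.
have [//|tr] := leP (release I j) t.
rewrite /processed set_itv_ge ?bnd_simp -?ltNge // integral_set0.
by rewrite lee_fin leNgt job_size_gt0.
Qed.

Let completion_ge j : ((release I j)%:E <= completion I z j)%E.
Proof. by apply: le_ereal_inf_tmp => _ [t /= h <-]; rewrite lee_fin processed_early. Qed.

Lemma completion_fineE j : completion I z j = (C j)%:E.
Proof.
rewrite /C fineK // fin_numElt cz andbT (lt_le_trans _ (completion_ge j)) //.
by rewrite ltNyr.
Qed.

Lemma completion_ge_release j : release I j <= C j.
Proof. by rewrite -lee_fin -completion_fineE. Qed.

Lemma processed_lt j t : release I j <= t -> t < C j ->
  fine (processed I z j t) < job_size I j.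
Proof.
move=> rt tC; rewrite ltNge; apply/negP => h.
move: tC; rewrite ltNge -lee_fin -completion_fineE => /negP; apply.
apply: ereal_inf_lbound; exists t => //=.
rewrite processedE -(fineK (work_fin_num t (tz j) (release_ge0 I j))) lee_fin.
exact: h.
Qed.

(** For [t] strictly after the infimum, some earlier time already meets the size, and work only
    grows; attainment of the infimum is thus avoided. *)
Lemma processed_ge j t : C j < t -> job_size I j <= fine (processed I z j t).
Proof.
rewrite -lte_fin -completion_fineE => /ereal_inf_lt[_ [t' h <-]].
rewrite lte_fin => t't; have rt' := processed_early h.
have r0 := release_ge0 I j.
rewrite -lee_fin processedE fineK ?(work_fin_num _ (tz j)) //.
rewrite (work_split (tz j) r0 rt' (ltW t't)) (le_trans h) // leeDl //.
by rewrite (work_ge0 _ (tz j)) // (le_trans r0).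
Qed.

Lemma size_le_flow_time j : 0 <= B -> job_size I j <= B * (C j - release I j).
Proof.
move=> B0; apply/ler_addgt0Pr => e e0.
pose d := e / (B + 1); have B1 : 0 < B + 1 by rewrite ltr_wpDl.
have d0 : 0 < d by rewrite divr_gt0.
have Ct : C j < C j + d by rewrite ltrDl.
apply: (le_trans (processed_ge Ct)); have r0 := release_ge0 I j.
have rC := completion_ge_release j.
rewrite -lee_fin processedE fineK ?(work_fin_num _ (tz j)) //.
apply: (le_trans (work_bounded B0 (tz j) r0 (le_trans rC (ltW Ct)))).
rewrite lee_fin addrAC mulrDr lerD2l /d mulrA ler_pdivrMr // mulrC.
by rewrite ler_wpM2l ?(ltW e0) // lerDl.
Qed.

Lemma weighted_flow_timeE : weighted_flow_time I z =
  (\sum_j weight I j * (C j - release I j))%:E.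
Proof.
rewrite /weighted_flow_time -sumEFin; apply: eq_bigr => j _.
by rewrite completion_fineE -EFinB -EFinM.
Qed.

End Completion.

(** * Work performed by the simulated rates *)

Section SimulationWork.
Variables (R : realType) (V : finType) (N : network R V).
Hypothesis adm : admissible N.
Variable I : job_sequence N.
Variable spd : R.
Hypothesis spd0 : 0 < spd.

Let B := rate_bound N.
Let B0 : 0 <= B := ltW (rate_bound_gt0 N).

Lemma plan_rate_measurable (L : plan N) (f : R -> R) j :
  measurable_fun [set: measurableTypeR R] (f : measurableTypeR R -> R) ->
  measurable_fun [set: measurableTypeR R] (fun t : measurableTypeR R => plan_rate L (f t) j).
Proof.
elim: L f => [|s L IH] f mf /=; first exact: measurable_cst.
rewrite (_ : (fun t => _) =
    fun t => if f t < s.1 then s.2 j else plan_rate L (f t - s.1) j); last first.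
  by apply/funext => t; case: ifP.
apply: measurable_fun_ifT => //.
- by apply: measurable_fun_ltr => //.
- by apply: IH; apply: measurable_funB.
Qed.

Definition sim_rate_at st es t : job N -> R :=
  sim_rate spd (state_at spd st es t) t.

Lemma sim_rate_at_measurable st es j :
  measurable_fun [set: measurableTypeR R]
    (fun t : measurableTypeR R => sim_rate_at st es t j).
Proof.
have mr st' : measurable_fun [set: measurableTypeR R]
    (fun t : measurableTypeR R => sim_rate spd st' t j).
  apply: plan_rate_measurable; apply: measurable_funM => //.
  exact: measurable_funB.
elim: es st => [|e es IH] st; first exact: mr.
rewrite (_ : (fun t => _) = fun t => if t < arr_time e then sim_rate spd st t j
    else sim_rate_at (sim_step spd st e) es t j); last first.
  by apply/funext => t; rewrite /sim_rate_at /=; case: ifP.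
by apply: measurable_fun_ifT => //; exact: measurable_fun_ltr.
Qed.

Let order (js : seq (job N)) :=
  sorted (fun j k => release I j <= release I k) js.

Let order_min j js : order (j :: js) ->
  forall k, k \in js -> release I j <= release I k.
Proof.
move=> sjs; have tr : transitive (fun j k => release I j <= release I k).
  by move=> ? ? ?; exact: le_trans.
by have /allP h := order_path_min tr sjs; exact: h.
Qed.

Let arr js := [seq arrival_of I j | j <- js].

Let step_inv st j js : uniq (j :: js) -> order (j :: js) ->
  sim_invariant I st (j :: js) ->
  let st' := sim_step spd st (arrival_of I j) in
  sim_invariant I st' js /\ forall k, plan_total (current st') k =
    residual spd st (release I j) k + (if k == j then job_size I j else 0).
Proof.
cbn [uniq]; case/andP=> jjs _ ojs inv.
have [? ? _] := sim_step_invariant adm (lexx 0) (ltW spd0) jjs (order_min ojs) inv.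
by [].
Qed.

Lemma sim_rate_at_feasible st js t : uniq js -> order js -> sim_invariant I st js ->
  feasible_rates (sim_rate_at st (arr js) t).
Proof.
elim: js st => [|j js IH] st ujs ojs inv.
  by have [vL _ _ _ _] := inv; exact: plan_rate_feasible.
rewrite /sim_rate_at /=; case: ltP => _.
  by have [vL _ _ _ _] := inv; exact: plan_rate_feasible.
have [inv' _] := step_inv ujs ojs inv.
by apply: IH => //; [case/andP: ujs|exact: path_sorted ojs].
Qed.

Let tame_rate (f : R -> job N -> R) j :
  measurable_fun [set: measurableTypeR R] (fun t : measurableTypeR R => f t j) ->
  (forall t, feasible_rates (f t)) -> tame (spd * B) (fun t => spd * f t j).
Proof.
move=> mf Qf; split=> [|t _].
  apply: measurable_funTS; exact: measurable_funM.
have := feasible_rates_bounded j (Qf t).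
by move=> fB; rewrite mulr_ge0 ?(ltW spd0) ?(Qf t).2 //= ler_pM2l.
Qed.

Let tame_plan (L : plan N) a j : valid_plan L ->
  tame (spd * B) (fun t => spd * plan_rate L (spd * (t - a)) j).
Proof.
move=> vL; apply: (@tame_rate (fun t => plan_rate L (spd * (t - a)))) => [|t].
  apply: plan_rate_measurable; apply: measurable_funM => //.
  exact: measurable_funB.
exact: plan_rate_feasible.
Qed.

Let tame_sim st js j : uniq js -> order js -> sim_invariant I st js ->
  tame (spd * B) (fun t => spd * sim_rate_at st (arr js) t j).
Proof.
move=> ujs ojs inv; apply: (@tame_rate (sim_rate_at st (arr js))) => [|t].
  exact: sim_rate_at_measurable.
exact: sim_rate_at_feasible.
Qed.

(** Induction on the plan, splitting the interval at [mid], the moment at which the first step ends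
    when traversed at speed [spd]. *)
Lemma plan_work (L : plan N) a b j : valid_plan L -> 0 <= a -> a <= b ->
  ((plan_total L j - plan_total (plan_after L (spd * (b - a))) j)%R%:E <=
   work (fun t => (spd * plan_rate L (spd * (t - a)) j)%R) a b)%E.
Proof.
elim: L a => [|s L IH] a vL a0 ab.
  by rewrite /= subrr (work_ge0 _ (tame_plan a j vL)).
have [s0 Qs vL'] : [/\ 0 <= s.1, feasible_rates s.2 & valid_plan L] by [].
have tc : tame (spd * B) (fun=> spd * s.2 j).
  split=> [|t _]; first exact: measurable_cst.
  by rewrite mulr_ge0 ?(ltW spd0) ?Qs.2 //= ler_pM2l // feasible_rates_bounded.
have tp := tame_plan a j vL.
pose mid := a + s.1 / spd.
have am : a <= mid by rewrite lerDl divr_ge0 // ltW.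
have midE : spd * (mid - a) = s.1 by rewrite /mid addrAC subrr add0r mulrC divfK ?gt_eqF.
have [bs|sb] := ltP (spd * (b - a)) s.1.
  rewrite (@work_eq_itvco _ _ _ (fun=> spd * s.2 j) _ _ tp tc) //.
    by rewrite work_cst //= bs /= lee_fin le_eqVlt; apply/orP; left; apply/eqP; ring.
  move=> x /andP[ax xb] /=.
  by rewrite (lt_trans _ bs) // ltr_pM2l // ltrD2r.
have mb : mid <= b by rewrite /mid -lerBrDl ler_pdivrMr // mulrC.
rewrite (work_split tp a0 am mb).
have -> : (plan_total (s :: L) j - plan_total (plan_after (s :: L) (spd * (b - a))) j)%:E =
    ((s.1 * s.2 j)%R%:E + (plan_total L j - plan_total (plan_after L (spd * (b - mid))) j)%R%:E)%E.
  rewrite -EFinD /= ltNge sb /= addrA; congr (_ - plan_total (plan_after _ _) _)%:E.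
  by rewrite -midE; ring.
apply: leeD.
  rewrite (@work_eq_itvco _ _ _ (fun=> spd * s.2 j) _ _ tp tc) //.
    by rewrite work_cst // mulrAC midE.
  by move=> x /andP[ax xm] /=; rewrite -midE ltr_pM2l // ltrD2r xm.
apply: (le_trans (IH mid vL' (le_trans a0 am) mb)).
apply: (work_le (tame_plan mid j vL') tp (le_trans a0 am)) => x /andP[mx _] /=.
have -> : (spd * (x - a) < s.1) = false.
  by apply/negbTE; rewrite -leNgt -midE ler_pM2l // lerD2r.
by rewrite (_ : spd * (x - a) - s.1 = spd * (x - mid)) // -midE; ring.
Qed.

(** Replanning changes the order of the work but not its amount, so whatever has left the residual
    since the release was processed. *)
Lemma sim_work st js t j : uniq js -> order js -> sim_invariant I st js ->
  clock st <= t -> release I j <= t ->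
  (((if j \in js then job_size I j else plan_total (current st) j) -
    residual spd (state_at spd st (arr js) t) t j)%R%:E <=
   work (fun x => (spd * sim_rate_at st (arr js) x j)%R)
     (if j \in js then release I j else clock st) t)%E.
Proof.
elim: js st => [|k js IH] st ujs ojs inv ct rt.
  have [vL _ _ _ [c0 _]] := inv; exact: plan_work.
have [vL L0 _ _ [c0 cr]] := inv.
have [inv' totE] := step_inv ujs ojs inv.
set st' := sim_step _ _ _ in inv' totE.
have ts := tame_sim j ujs ojs inv.
have [kjs ujs'] : k \notin js /\ uniq js by apply/andP.
have ojs' : order js := path_sorted ojs.
have ts' := tame_sim j ujs' ojs' inv'.
have ck : clock st <= release I k by have := cr k; rewrite inE eqxx.
have tp := tame_plan (clock st) j vL.
have early x : x < release I k -> sim_rate_at st (arr (k :: js)) x = sim_rate spd st x.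
  by move=> xk; rewrite /sim_rate_at /= xk.
have late x : release I k <= x ->
    sim_rate_at st (arr (k :: js)) x = sim_rate_at st' (arr js) x.
  by move=> kx; rewrite /sim_rate_at /= ltNge kx.
have [tk|kt] := ltP t (release I k).
  have jkjs : j \notin k :: js.
    rewrite inE negb_or; apply/andP; split.
      by apply: contraTneq rt => ->; rewrite -ltNge.
    apply/negP => /(order_min ojs) h.
    by move: (lt_le_trans tk h); rewrite ltNge rt.
  rewrite (negbTE jkjs) (@work_eq_itvco _ _ _ _ _ _ ts tp) //.
    by rewrite /= tk; exact: plan_work.
  by move=> x /andP[_ xt]; rewrite early // (lt_trans xt).
have -> : state_at spd st (arr (k :: js)) t = state_at spd st' (arr js) t.
  by rewrite /= ltNge kt.
have ck0 : 0 <= release I k := release_ge0 I k.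
have workE a : release I k <= a ->
    (work (fun x => (spd * sim_rate_at st' (arr js) x j)%R) a t <=
     work (fun x => (spd * sim_rate_at st (arr (k :: js)) x j)%R) a t)%E.
  move=> ka; apply: (work_le ts' ts (le_trans ck0 ka)) => x /andP[ax _].
  by rewrite late // (le_trans ka).
have IHt := IH st' ujs' ojs' inv' kt rt.
have res0 : 0 <= residual spd st (release I k) j.
  apply: plan_total_ge0; apply: valid_plan_after => //.
  by rewrite mulr_ge0 ?subr_ge0 // ltW.
(* Three cases: [j] is the job now arriving, a later one, or one present before, for which the work
   is split at this arrival. *)
rewrite inE; have [jk|jk] /= := eqVneq j k.
  subst j; move: IHt; rewrite (negbTE kjs) totE eqxx => IHt.
  apply: le_trans (workE _ (lexx _)); apply: le_trans IHt.
  by rewrite lee_fin lerD2r lerDr.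
have [jjs|jjs] := boolP (j \in js).
  move: IHt; rewrite jjs => /le_trans; apply; apply: workE.
  exact: (order_min ojs).
move: IHt; rewrite (negbTE jjs) totE (negbTE jk) addr0 => IHt.
rewrite (work_split ts c0 ck kt).
set r' := residual spd (state_at _ _ _ _) t j in IHt *.
have -> : plan_total (current st) j - r' =
    (plan_total (current st) j - residual spd st (release I k) j) +
    (residual spd st (release I k) j - r') by ring.
rewrite EFinD; apply: leeD; last exact: le_trans IHt (workE _ (lexx _)).
rewrite (@work_eq_itvco _ _ _ _ _ _ ts tp) //; first exact: plan_work.
by move=> x /andP[_ xk]; rewrite early.
Qed.

End SimulationWork.

(** * The algorithm and its competitive ratio *)

Section Algorithm.
Variable R : realType.
Variable eta eps : R.

Let spd := 1 + 2 * eta.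

Definition base_rates (V : finType) (N : network R V) : job N -> R :=
  xget (fun=> 0) [set z | feasible_rates z /\ forall j, 0 < z j].

Arguments base_rates {V} N _.

(* Speed [1 + eta] on top of the simulated rates converts fractional into
   integral flow time; the remaining speed goes to [base_rates], so that the jobs
   of weight [0], which the simulation ignores, are completed as well. *)
Definition algorithm_schedule (V : finType) (N : network R V)
    (I : job_sequence N) : schedule N := fun t j =>
  (1 + eta) * (spd * sim_rate_at spd (sim_init N) (arrivals I) t j) +
  (1 + eps - (1 + eta) * spd) * base_rates N j.

Lemma algorithm_nonanticipative (V : finType) (N : network R V)
    (I I' : job_sequence N) (t : R) :
  same_arrivals t I I' ->
  forall j, algorithm_schedule I t j = algorithm_schedule I' t j.
Proof.
move=> II' j; rewrite /algorithm_schedule /sim_rate_at.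
by rewrite (state_at_arrivals_local spd II').
Qed.

Definition algorithm : online_algorithm R :=
  OnlineAlgorithm algorithm_nonanticipative.

Hypotheses (eta0 : 0 < eta) (eta_le : eta <= 1 / 8) (eta_eps : 8 * eta <= eps).

Ltac eta_lra := have := eta0; have := eta_le; have := eta_eps; lra.

Let spd0 : 0 < spd. Proof. by rewrite /spd; eta_lra. Qed.
(** The speed left over: [(1 + eta) * spd] exceeds 1 by [3 eta + 2 eta^2], which is less than
    [8 eta <= eps]. *)
Let del := 1 + eps - (1 + eta) * spd.
Let del0 : 0 < del.
Proof.
rewrite /del /spd; have : eta * eta <= eta * (1 / 8) by rewrite ler_wpM2l // ltW.
eta_lra.
Qed.

Section Network.
Variables (V : finType) (N : network R V).
Hypothesis adm : admissible N.
Variable I : job_sequence N.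

Let B := rate_bound N.
Let B0 : 0 <= B := ltW (rate_bound_gt0 N).
Let z := algorithm_schedule I.
Let srate := sim_rate_at spd (sim_init N) (arrivals I).

Let base_ratesP : feasible_rates (base_rates N) /\ forall j, 0 < base_rates N j.
Proof.
rewrite /base_rates; set S := [set z | _]; suff : S (xget (fun=> 0) S) by [].
have [q Qq q0] := positive_feasible_rates adm.
by apply: xgetPex; exists q.
Qed.

Let srate_feasible t : feasible_rates (srate t).
Proof.
rewrite /srate arrivalsE; apply: (sim_rate_at_feasible adm spd0).
- exact: job_order_uniq.
- exact: job_order_sorted.
- exact: sim_invariant_init.
Qed.

Let zE t j : z t j = (1 + eta) * (spd * srate t j) + del * base_rates N j.
Proof. by []. Qed.

Let z_feasible t : exists2 q, feasible_rates q & (fun j => (1 + eps) * q j) = z t.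
Proof.
have [Qb _] := base_ratesP; have e0 : 0 < 1 + eps by eta_lra.
exists (fun j => (1 + eta) * spd / (1 + eps) * srate t j +
                 del / (1 + eps) * base_rates N j).
  apply: feasible_rates_convex => //.
  - by rewrite divr_ge0 ?(ltW e0) // mulr_ge0 ?(ltW spd0) //; eta_lra.
  - by rewrite divr_ge0 ?(ltW e0) // ltW.
  - by rewrite -mulrDl /del addrC subrK divff // gt_eqF.
by apply/funext => j; rewrite zE; field; rewrite gt_eqF.
Qed.

Let srate_measurable j : measurable_fun (`[0, +oo[%classic : set (measurableTypeR R))
  (fun t => srate t j).
Proof. by apply: measurable_funTS; exact: sim_rate_at_measurable. Qed.

Let z_tame j : tame ((1 + eps) * B) (fun t => z t j).
Proof.
split=> [|t _].
  apply: measurable_funD => //; apply: measurable_funM => //.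
  by apply: measurable_funM => //; exact: srate_measurable.
have [q Qq <-] := z_feasible t; have e0 : 0 < 1 + eps by eta_lra.
by rewrite mulr_ge0 ?(ltW e0) ?Qq.2 //= ler_pM2l // feasible_rates_bounded.
Qed.

Let srate_tame j : tame (spd * B) (fun t => spd * srate t j).
Proof.
split=> [|t _]; first by apply: measurable_funM => //; exact: srate_measurable.
have Qs := srate_feasible t.
by rewrite mulr_ge0 ?(ltW spd0) ?Qs.2 //= ler_pM2l // feasible_rates_bounded.
Qed.

Let z_completion j : (completion I z j < +oo)%E.
Proof.
have [Qb bP] := base_ratesP; have db : 0 < del * base_rates N j by rewrite mulr_gt0.
pose t := release I j + job_size I j / (del * base_rates N j).
have r0 := release_ge0 I j.
have rt : release I j <= t by rewrite lerDl divr_ge0 // ltW ?job_size_gt0.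
apply: (@le_lt_trans _ _ t%:E); last by rewrite ltry.
apply: ereal_inf_lbound; exists t => //=.
have -> : (job_size I j)%:E =
    work (fun=> del * base_rates N j) (release I j) t.
  rewrite work_cst // /t addrAC subrr add0r mulrC divfK // gt_eqF //.
apply: (work_le (tame_cst (ltW db)) (z_tame j) r0) => x _.
rewrite zE lerDr mulr_ge0 // ?mulr_ge0 ?(ltW spd0) ?(srate_feasible _).2 //; eta_lra.
Qed.

Lemma algorithm_feasible : feasible_schedule (1 + eps) I z.
Proof.
split=> [j|t t0|j]; [exact: (z_tame j).1| |exact: z_completion].
exact: z_feasible.
Qed.

Lemma algorithm_cost (y : schedule N) : feasible_schedule 1 I y ->
  (weighted_flow_time I z <=
   (5 / eta ^+ 2)%:E * weighted_flow_time I y)%E.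
Proof.
move=> [my Qy cy].
have Qy' t : 0 <= t -> feasible_rates (y t).
  move=> t0; have [q Qq <-] := Qy t t0.
  by rewrite (_ : (fun j => 1 * q j) = q) //; apply/funext => j; rewrite mul1r.
have ty j : tame B (fun t => y t j).
  split=> [|t t0]; first exact: my.
  by rewrite (Qy' t t0).2 feasible_rates_bounded //; exact: Qy'.
rewrite (weighted_flow_timeE z_completion) (weighted_flow_timeE cy) -EFinM lee_fin.
pose CA j := fine (completion I z j).
pose CO j := fine (completion I y j).
pose P j t := fine (processed I y j t).
(* Truncated at 0, since the optimum may keep giving rate to a completed job. *)
pose Y t j := Num.max 0 (job_size I j - P j t).
(* [scaled_rates_work] is applied with [theta = eta]. [kap] comes from [(1 + eta) * (p - u) < p],
   valid for a job of size [p] not completed, with simulated residual [u]. *)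
pose sg := 1 + eta.
pose kap := eta / (1 + eta).
have lam0 : 0 < 1 + eta by eta_lra.
have r0 j := release_ge0 I j.
have P_split j t t' : release I j <= t -> t <= t' ->
    P j t' = P j t + fine (work (fun x => y x j) t t').
  move=> rt tt'; have t0 := le_trans (r0 j) rt.
  rewrite /P [processed I y j t'](work_split (ty j) (r0 j) rt tt').
  by rewrite fineD // (work_fin_num _ (ty j)).
have P0 j t : 0 <= P j t by rewrite fine_ge0 // (work_ge0 _ (ty j)).
have work0 j t t' : 0 <= t -> 0 <= fine (work (fun x => y x j) t t').
  by move=> t0; rewrite fine_ge0 // (work_ge0 _ (ty j)).
have h := @total_flow_bound _ _ _ adm I spd sg kap _ _ _ Y CA CO.
have {h} : (spd - sg) / 2 * kap * (\sum_j weight I j * (CA j - release I j)) <=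
    ((spd + sg) / 2 + 1) * \sum_j weight I j * (CO j - release I j).
  apply: h.
  - by rewrite /sg; eta_lra.
  - by rewrite /sg /spd; eta_lra.
  - by rewrite /kap divr_ge0 // ltW.
  - move=> t t' t0 tt'; have tt0 : 0 <= t' - t by rewrite subr_ge0.
    apply: (scaled_rates_le adm _ (scaled_rates_work adm ty Qy' eta0 t0 tt')).
      by rewrite mulr_ge0 // ltW.
    move=> j; case: (leP (release I j) t) => rt; last by rewrite lexx work0.
    have w0 := work0 j t t' t0.
    rewrite /Y (P_split j t t' rt tt'); move: w0; set u := fine _ => w0.
    case: (leP 0 (job_size I j - P j t)); case: (leP 0 (job_size I j - (P j t + u)));
      move=> ? ?; apply/andP; split; lra.
  - move=> t j rt; rewrite /Y; have := P0 j t; have := job_size_gt0 I j.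
    by case: (leP 0 (job_size I j - P j t)) => ? ? ?; apply/andP; split; lra.
  - move=> j; rewrite /Y.
    have -> : P j (release I j) = 0.
      by rewrite /P /processed set_itv1 integral_set1.
    by rewrite subr0 max_r // ltW // job_size_gt0.
  - move=> t j Ct; rewrite /Y max_l // subr_le0.
    exact: (processed_ge ty).
  - exact: completion_ge_release.
  - exact: completion_ge_release.
  - by move=> j; exact: (size_le_flow_time ty).
  move=> t j rt tC; have := processed_lt z_tame z_completion rt tC.
  set st := state_at _ _ _ t; set u := residual spd st t j => lt_p.
  have t0 : 0 <= t := le_trans (r0 j) rt.
  have sw : ((job_size I j - u)%:E <= work (fun x => (spd * srate x j)%R) (release I j) t)%E.
    have := @sim_work _ _ _ adm I spd spd0 (sim_init N) (job_order I) t j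
      (job_order_uniq I) (job_order_sorted I) (sim_invariant_init I) t0 rt.
    by rewrite mem_job_order -arrivalsE.
  have sw' : ((1 + eta) * (job_size I j - u) <= fine (processed I z j t)).
    have tl : tame ((1 + eta) * (spd * B)) (fun x => (1 + eta) * (spd * srate x j)).
      split=> [|x x0]; first by apply: measurable_funM => //; exact: (srate_tame j).1.
      have /andP[h1 h2] := (srate_tame j).2 x x0.
      by rewrite mulr_ge0 ?(ltW lam0) //= ler_pM2l.
    rewrite -lee_fin [X in (_ <= X)%E]fineK; last exact: (work_fin_num _ (z_tame j)).
    apply: (@le_trans _ _ (work (fun x => (1 + eta) * (spd * srate x j)) (release I j) t)).
      rewrite /work; under eq_integral do rewrite EFinM.
      rewrite ge0_integralZl_EFin //; first by rewrite EFinM lee_wpmul2l // lee_fin ltW.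
      - by move=> x; exact: (tame_ge0 (srate_tame j) (r0 j)).
      - exact: (tame_measurable (srate_tame j) (r0 j)).
      - exact: ltW.
    apply: (work_le tl (z_tame j) (r0 j)) => x _.
    by rewrite zE lerDl mulr_ge0 // ltW //; case: base_ratesP.
  have : (1 + eta) * (job_size I j - u) < job_size I j by exact: le_lt_trans lt_p.
  rewrite /kap mulrAC ler_pdivrMr //; lra.
set SA := \sum_j _ * (CA j - _); set SO := \sum_j _ * (CO j - _) => main.
have SO0 : 0 <= SO.
  apply: sumr_ge0 => j _; rewrite mulr_ge0 ?weight_ge0 // subr_ge0.
  exact: completion_ge_release.
have e20 : 0 < eta ^+ 2 by rewrite exprn_gt0.
rewrite -/SA -/SO mulrAC ler_pdivlMr //.
(* The ratio is [(4 + 3 eta) * (1 + eta) / eta^2], and the numerator is below 5 for [eta <= 1/8]. *)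
have k1E : (spd - sg) / 2 * kap = eta ^+ 2 / (2 * (1 + eta)).
  by rewrite /spd /sg /kap; field; rewrite gt_eqF.
move: main; rewrite k1E mulrAC ler_pdivrMr ?mulr_gt0 // [_ * SA]mulrC => /le_trans; apply.
rewrite mulrAC ler_wpM2r // /spd /sg.
have : eta * eta <= eta * (1 / 8) by rewrite ler_wpM2l // ltW.
eta_lra.
Qed.

End Network.
End Algorithm.

(* The factor max(1, 1/eps^2) equals 1/eps^2 for eps <= 1; for large eps a
   bound C/eps^2 is impossible, a single job taking at least 1/(1+eps) times
   its optimal flow time. *)
Theorem mainTheorem7 (R : realType) :
  exists2 C : R, 0 < C &
    forall eps : R, 0 < eps ->
      exists A : online_algorithm R,
        competitive (1 + eps) (C * Num.max 1 (1 / eps ^+ 2)) A.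
Proof.
(* With [eta = min(1, eps) / 8], the ratio [5 / eta^2] is [320 / min(1, eps)^2]. *)
exists 320 => // eps eps0.
pose eta : R := Num.min 1 eps / 8.
have m0 : 0 < Num.min 1 eps by rewrite lt_min ltr01.
have eta0 : 0 < eta by rewrite divr_gt0.
have eta_le : eta <= 1 / 8 by rewrite ler_pM2r ?invr_gt0 // ge_min lexx.
have eta_eps : 8 * eta <= eps by rewrite /eta mulrC divfK ?ge_min ?lexx ?orbT.
have cE : 320 * Num.max 1 (1 / eps ^+ 2) = 5 / eta ^+ 2.
  rewrite /eta; have [e1|e1] := leP 1 eps.
    rewrite max_l; first by field.
    by rewrite ler_pdivrMr ?exprn_gt0 // mul1r exprn_ege1.
  rewrite max_r; first by field; rewrite gt_eqF.
  by rewrite ler_pdivlMr ?exprn_gt0 // mul1r exprn_ile1 // ltW.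
have c0 : 0 < 5 / eta ^+ 2 by rewrite divr_gt0 // exprn_gt0.
exists (algorithm eta eps) => V N adm I; split.
  exact: algorithm_feasible.
rewrite cE -lee_pdivrMl //; apply: le_ereal_inf_tmp => _ [y yP <-].
rewrite lee_pdivrMl //; exact: algorithm_cost.
Qed.
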